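(* Let $\Omega \subset \mathbb{R}^d$ be a bounded domain and let $k(x,z) = \Phi(x-z)$ be a translational invariant kernel whose Fourier transform satisfies, for some $\tau>d/2$ and constants $c_\Phi,C_\Phi>0$, $$c_\Phi (1+\|\omega\|^2)^{-\tau} \le \hat\Phi(\omega) \le C_\Phi (1+\|\omega\|^2)^{-\tau} \qquad\text{for all }\omega\in\mathbb{R}^d .$$ Then there are constants $c, c' > 0$, depending only on the dimension $d$, the kernel $k$ and the domain $\Omega$, such that for any finite set $X \subset \Omega$ of $n := |X|$ pairwise distinct points it holds $$\lambda_{\min}(k^*(X,X)) \;\ge\; c\, q^d \cdot \lambda_{\min}(k(X,X))^2 \;\ge\; c'\, q^{4\tau-d}$$ with $q := \min(\mathrm{dist}(X,\partial\Omega), q_X) > 0$.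
   Context: $\|\cdot\|$ is the Euclidean norm and $\lambda_{\min}$ denotes the smallest eigenvalue of a symmetric matrix. A translational invariant kernel is a symmetric kernel of the form $k(x,z)=\Phi(x-z)$ with $\Phi:\mathbb{R}^d\to\mathbb{R}$; the Fourier transform $\hat\Phi:\mathbb{R}^d\to\mathbb{R}$ is normalized so that $\Phi(x-z)=(2\pi)^{-d/2}\int_{\mathbb{R}^d}\hat\Phi(\omega)e^{i\omega^\top(x-z)}\,d\omega$. The convolutional kernel $k^*:\Omega\times\Omega\to\mathbb{R}$ of $k$ is $k^*(x,z) := \int_\Omega k(x,y)\,k(y,z)\,dy$. For $X=\{x_1,\dots,x_n\}$, the kernel matrices are $k(X,X):=(k(x_i,x_j))_{1\le i,j\le n}$ and $k^*(X,X):=(k^*(x_i,x_j))_{1\le i,j\le n}$. The separation distance (for $n\ge2$) is $q_X:=\frac12\min_{x_i\ne x_j\in X}\|x_i-x_j\|$, and $\mathrm{dist}(X,\partial\Omega)$ is the distance of $X$ to the boundary of $\Omega$. *)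

(* Defs.v *)
From HB Require Import structures.
From mathcomp Require Import all_boot all_order all_algebra.
From mathcomp Require Import all_classical all_reals all_analysis.
From mathcomp Require Import complex.

Set Implicit Arguments.
Unset Strict Implicit.
Unset Printing Implicit Defensive.

Import Order.TTheory GRing.Theory Num.Theory.
Import numFieldNormedType.Exports.

Local Open Scope classical_set_scope.
Local Open Scope ring_scope.

Definition measure_rV_display : measure_display -> measure_display.
Proof. exact. Qed.

(* The product sigma-algebra on row vectors, generated by the coordinates.
   Over the reals this is the Borel sigma-algebra of R^n. *)
Section measurable_rV.
Context {d} {T : measurableType d}.
Variable n : nat.

Let coord : 'I_n -> 'rV[T]_n -> T := fun i v => v ord0 i.

Let rV_set0 : g_sigma_preimage coord set0.
Proof. exact: sigma_algebra0. Qed.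

Let rV_setC A : g_sigma_preimage coord A -> g_sigma_preimage coord (~` A).
Proof. exact: sigma_algebraC. Qed.

Let rV_bigcup (F : _^nat) : (forall i, g_sigma_preimage coord (F i)) ->
  g_sigma_preimage coord (\bigcup_i (F i)).
Proof. exact: sigma_algebra_bigcup. Qed.

HB.instance Definition _ := @isMeasurable.Build (measure_rV_display d)
  'rV[T]_n (g_sigma_preimage coord) rV_set0 rV_setC rV_bigcup.

End measurable_rV.

Lemma measurable_rV_coord d (T : measurableType d) n (i : 'I_n) :
  measurable_fun [set: 'rV[T]_n] (fun v => v ord0 i).
Proof.
move=> _ Y mY; rewrite setTI; apply: sub_sigma_algebra => /=.
rewrite -bigcup_seq/=; exists i => /=; first by rewrite mem_index_enum.
by exists Y => //; rewrite setTI.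
Qed.

Lemma measurable_fun_rVP d1 d2 (T1 : measurableType d1)
    (T2 : measurableType d2) n (f : T1 -> 'rV[T2]_n) :
  measurable_fun [set: T1] f <->
  forall i, measurable_fun [set: T1] (fun x => f x ord0 i).
Proof.
split=> [mf i|mf].
  exact: (measurableT_comp (@measurable_rV_coord _ T2 n i) mf).
have key : g_sigma_preimage (fun (i : 'I_n) x => f x ord0 i) `<=` measurable.
  apply: smallest_sub; first exact: sigma_algebra_measurable.
  rewrite -bigcup_seq; apply: bigcup_sub => i _.
  by move=> A [B mB <-]; exact: mf.
move=> _ A mA; apply: key.
have -> : g_sigma_preimage (fun (i : 'I_n) x => f x ord0 i) =
    preimage_set_system setT f
      (g_sigma_preimage (fun (i : 'I_n) (v : 'rV[T2]_n) => v ord0 i)).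
  exact: (@g_sigma_preimage_comp _ _ n _
    (fun (i : 'I_n) (v : 'rV[T2]_n) => v ord0 i) _ f).
by exists A.
Qed.

Section lebesgue_rV.
Context {R : realType}.

Definition rV_cons n (p : measurableTypeR R * 'rV[R]_n) :
    'rV[R]_n.+1 :=
  \row_(i < n.+1) if unlift ord0 i is Some j then p.2 ord0 j else p.1.

Lemma rV_cons0 n p : @rV_cons n p ord0 ord0 = p.1.
Proof. by rewrite mxE unlift_none. Qed.

Lemma rV_consS n p i : @rV_cons n p ord0 (lift ord0 i) = p.2 ord0 i.
Proof. by rewrite mxE liftK. Qed.

Lemma measurable_rV_cons n : measurable_fun setT (@rV_cons n).
Proof.
apply/measurable_fun_rVP => i; have [j ->|->] := unliftP ord0 i.
  apply: (eq_measurable_fun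
    (fun p : measurableTypeR R * 'rV[R]_n => p.2 ord0 j)).
    by move=> p _; rewrite rV_consS.
  exact: (measurableT_comp (@measurable_rV_coord _ _ n j) measurable_snd).
apply: (eq_measurable_fun fst) => [p _|]; last exact: measurable_fst.
by rewrite rV_cons0.
Qed.

Section step.
Local Open Scope ereal_scope.
Variable n : nat.
Variable m : {sigma_finite_measure set 'rV[R]_n -> \bar R}.

Definition lebesgue_step : set 'rV[R]_n.+1 -> \bar R :=
  pushforward (lebesgue_measure \x m) (@rV_cons n).

Let mcons := @measurable_rV_cons n.

Let step0 : lebesgue_step set0 = 0.
Proof. exact: measure0. Qed.

Let step_ge0 A : 0 <= lebesgue_step A.
Proof. exact: measure_ge0. Qed.

Let step_sigma_additive : semi_sigma_additive lebesgue_step.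
Proof. exact: measure_semi_sigma_additive. Qed.

HB.instance Definition _ := isMeasure.Build _ _ _ lebesgue_step
  step0 step_ge0 step_sigma_additive.

Lemma lebesgue_step_cons (A : set (measurableTypeR R))
    (B : set 'rV[R]_n) : measurable A -> measurable B ->
  lebesgue_step [set v | A (v ord0 ord0) /\
                         B (\row_j v ord0 (lift ord0 j))] =
  lebesgue_measure A * m B.
Proof.
move=> mA mB; rewrite -product_measure1E//; congr (product_measure1 _ _ _).
apply/seteqP; split=> -[x v] /=; rewrite rV_cons0;
  rewrite (_ : \row_j _ = v)//; by apply/rowP => j; rewrite mxE rV_consS.
Qed.

Let step_sigma_finite : sigma_finite setT lebesgue_step.
Proof.
pose l : {sigma_finite_measure set (measurableTypeR R) -> \bar R} :=
  lebesgue_measure.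
have /sigma_finiteP[G [TG ndG Goo]] := sigma_finiteT l.
have /sigma_finiteP[H [TH ndH Hoo]] := sigma_finiteT m.
exists (fun k => [set v : 'rV[R]_n.+1 |
    G k (v ord0 ord0) /\ H k (\row_j v ord0 (lift ord0 j))]).
  apply/esym; rewrite -subTset => v _.
  have [i _ Gi] : (\bigcup_i G i) (v ord0 ord0) by rewrite -TG.
  have [j _ Hj] : (\bigcup_i H i) (\row_j v ord0 (lift ord0 j)) by rewrite -TH.
  exists (maxn i j) => //; split.
    by move: Gi; exact/subsetPset/ndG/leq_maxl.
  by move: Hj; exact/subsetPset/ndH/leq_maxr.
move=> k; have [mG Gk] := Goo k; have [mH Hk] := Hoo k; split.
  apply: measurableI.
    by rewrite -[X in measurable X]setTI; exact: measurable_rV_coord.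
  rewrite -[X in measurable X]setTI.
  have mS : measurable_fun setT (fun v : 'rV[R]_n.+1 =>
      \row_j v ord0 (lift ord0 j) : 'rV[R]_n).
    apply/measurable_fun_rVP => j; apply: (eq_measurable_fun
      (fun v : 'rV[R]_n.+1 => v ord0 (lift ord0 j))).
      by move=> v _; rewrite /= mxE.
    exact: measurable_rV_coord.
  exact: mS.
by rewrite lebesgue_step_cons// lte_mul_pinfty// ge0_fin_numE.
Qed.

HB.instance Definition _ := Measure_isSigmaFinite.Build _ _ _ lebesgue_step
  step_sigma_finite.

End step.

(* Lebesgue measure on R^n, as an iterated product measure; lebesgue_rV_box
   checks that it gives boxes their volume. *)
Fixpoint lebesgue_rV n :
    {sigma_finite_measure set 'rV[R]_n -> \bar R} :=
  if n is n'.+1 then lebesgue_step (lebesgue_rV n')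
  else \d_ (0 : 'rV[R]_0).

Lemma lebesgue_rV_box n (a b : 'rV[R]_n) :
  (forall i, a ord0 i <= b ord0 i) ->
  lebesgue_rV n [set v | forall i, v ord0 i \in `[a ord0 i, b ord0 i]] =
  (\prod_(i < n) (b ord0 i - a ord0 i))%:E.
Proof.
elim: n a b => [|n IHn] a b ab.
  by rewrite big_ord0 /= diracE mem_set// => -[].
pose t (v : 'rV[R]_n.+1) : 'rV[R]_n := \row_j v ord0 (lift ord0 j).
have tab i : t a ord0 i <= t b ord0 i by rewrite !mxE.
pose B : set 'rV[R]_n := \bigcap_(i in [set: 'I_n])
  (fun v : 'rV[R]_n => v ord0 i) @^-1`
    [set` `[t a ord0 i, t b ord0 i]].
have mB : measurable B.
  apply: fin_bigcap_measurable => // i _.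
  rewrite -[X in measurable X]setTI.
  exact: (@measurable_rV_coord _ R).
have BE : lebesgue_rV n B = (\prod_(i < n) (t b ord0 i - t a ord0 i))%:E.
  rewrite -(IHn _ _ tab); congr (lebesgue_rV n _).
  by apply/seteqP; split=> [v vab i|v vab i _]; exact: vab.
have := lebesgue_step_cons (lebesgue_rV n)
  (measurable_itv `[a ord0 ord0, b ord0 ord0]) mB.
rewrite BE lebesgue_measure_itv/= lte_fin => stepE.
transitivity (lebesgue_step (lebesgue_rV n)
  [set v | [set` `[a ord0 ord0, b ord0 ord0]] (v ord0 ord0) /\
           B (\row_j v ord0 (lift ord0 j))]).
  congr (lebesgue_step _ _); apply/seteqP; split=> v /=.
    move=> vab; split; first exact: vab.
    by move=> i _; rewrite /= !mxE; exact: vab.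
  move=> [v0 vS] i; have [j ->|->//] := unliftP ord0 i.
  by have := vS j I; rewrite /= !mxE.
rewrite stepE big_ord_recl EFinM; congr (_ * _)%E; last first.
  by congr EFin; apply: eq_bigr => i _; rewrite !mxE.
have := ab ord0; rewrite le_eqVlt => /predU1P[->|->]; last by rewrite EFinB.
by rewrite ltxx subrr.
Qed.

End lebesgue_rV.

Section kernels.
Context {R : realType} {d : nat}.
Implicit Types (x y z w : 'rV[R]_d) (Omega : set 'rV[R]_d).
Implicit Types (Phi : 'rV[R]_d -> R) (k : 'rV[R]_d -> 'rV[R]_d -> R).

Definition dotv x y : R := \sum_(i < d) x ord0 i * y ord0 i.

(* The library's norm on row vectors is the sup norm; it induces the same
   topology and the same bounded sets as this one. *)
Definition enorm x : R := Num.sqrt (dotv x x).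

Definition is_domain Omega : Prop :=
  [/\ Omega !=set0, open Omega & connected Omega].

Definition boundary Omega : set 'rV[R]_d := closure Omega `\` Omega°.

Definition expi (t : R) : R[i] := (cos t +i* sin t)%C.

Definition cintegral (f : 'rV[R]_d -> R[i]) : R[i] :=
  ((\int[lebesgue_rV d]_w complex.Re (f w)) +i*
   (\int[lebesgue_rV d]_w complex.Im (f w)))%C.

(* Phihat is the real-valued Fourier transform of Phi, in the normalization
   given by the (absolutely convergent) inversion formula. *)
Definition fourier_transform_of Phi (Phihat : 'rV[R]_d -> R) : Prop :=
  (lebesgue_rV d).-integrable setT (EFin \o Phihat) /\
  forall x, (Phi x)%:C%C =
    ((2 * pi) `^ (- (d%:R / 2)))%:C%C *
    cintegral (fun w => (Phihat w)%:C%C * expi (dotv w x)).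

Definition translational_invariant k Phi : Prop :=
  (forall x z, k x z = k z x) /\ (forall x z, k x z = Phi (x - z)).

Definition conv_kernel Omega k x z : R :=
  \int[lebesgue_rV d]_(y in Omega) (k x y * k y z).

Definition kernel_matrix n k (X : 'I_n -> 'rV[R]_d) : 'M[R]_n :=
  \matrix_(i, j) k (X i) (X j).

(* Meaningful when A has an eigenvalue, e.g. symmetric of size n > 0. *)
Definition lambda_min n (A : 'M[R]_n) : R := inf [set a | eigenvalue A a].

Definition dist_boundary Omega n (X : 'I_n -> 'rV[R]_d) : \bar R :=
  ereal_inf [set r | exists i y,
    boundary Omega y /\ r = (enorm (X i - y))%:E].

(* +oo for a single point: the infimum is then over the empty set. *)
Definition sep_dist n (X : 'I_n -> 'rV[R]_d) : \bar R :=
  (2^-1%:E * ereal_inf [set r | exists i j,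
    X i != X j /\ r = (enorm (X i - X j))%:E])%E.

(* A real number when X is nonempty and Omega has nonempty boundary, as holds
   for nonempty bounded Omega in dimension d > 0. *)
Definition scale Omega n (X : 'I_n -> 'rV[R]_d) : R :=
  fine (Order.min (dist_boundary Omega X) (sep_dist X)).

End kernels.

(* Main.v *)
Require Import Defs.
From mathcomp Require Import all_boot all_order all_algebra.
From mathcomp Require Import all_classical all_reals all_analysis.
From mathcomp Require Import measurable_realfun complex ring lra.
Import Order.TTheory GRing.Theory Num.Theory.
Import numFieldNormedType.Exports.
Set Implicit Arguments.
Unset Strict Implicit.
Unset Printing Implicit Defensive.
Local Open Scope classical_set_scope.
Local Open Scope ring_scope.

(** Write f = sum_i a_i k(x_i, .), so that a^T k*(X,X) a is the integral of f^2
    over Omega. The cubes of side 2 eps q around the points x_j are disjoint and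
    contained in Omega for small eps, hence it is enough to bound
    sum_j f(x_j + u)^2 from below for every fixed shift u in such a cube centred
    at the origin and then to integrate over u: this integration produces the
    factor q^d.

    For fixed u, pair f(x_j + u) with a_j. The pairing is the shifted quadratic
    form sum_ij a_i a_j Phi(x_i - x_j - u), which by Fourier inversion is a
    positive constant times the integral of Phihat(w) |A(w)|^2 cos(w . u), where
    A(w) = sum_j a_j exp(i w . x_j). If the frequencies outside a box of size
    Lambda / q carry at most a sixth of the total energy, i.e. of the integral of
    Phihat |A|^2, and if |w . u| <= 1 on that box, then the shifted form is at
    least a quarter of the unshifted form a^T k(X,X) a, so at least
    lambda_min(k(X,X)) |a|^2 / 4
    ([shifted_energy], [sum_sq_lower], [conv_form_lower]).

    The energy estimates come from a large sieve inequality
    ([expsum_window_bounds]): integrated against a window of width s, much larger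
    than the inverse separation of the points, |A|^2 behaves like the constant
    |a|^2, because the Gram matrix of the exponentials is close to a multiple of
    the identity. A window of width comparable to 1/q gives
    energy >= c q^(2 tau - d) |a|^2 ([energy_low]); this is also the lower bound
    on lambda_min(k(X,X)) that yields the second inequality. Windows of widths
    2^k s on the dyadic shells of the complement of a box of size s give
    (high-frequency energy) <= C s^(d - 2 tau) |a|^2 ([energy_high]), a geometric
    series because 2 tau > d. With s = Lambda / q both bounds scale like
    q^(2 tau - d), and the second has the extra factor Lambda^(d - 2 tau), which
    is small for large Lambda ([cutoff_exists]). *)

(** * Lebesgue measure on row vectors *)

Section rV_integration.
Context {R : realType}.
Local Notation mu1 := (@lebesgue_measure R).

Lemma measurable_coord n (i : 'I_n) :
  measurable_fun setT (fun v : 'rV[R]_n => v ord0 i : R).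
Proof. exact: (@measurable_rV_coord _ (measurableTypeR R)). Qed.

Lemma measurable_dotv n (z : 'rV[R]_n) :
  measurable_fun setT (fun v : 'rV[R]_n => dotv v z).
Proof.
by apply: measurable_sum => i; apply: measurable_funM => //; exact: measurable_coord.
Qed.

Lemma measurable_addv n (z : 'rV[R]_n) :
  measurable_fun setT (fun v : 'rV[R]_n => v + z).
Proof.
apply/(@measurable_fun_rVP _ _ _ (measurableTypeR R)) => i.
apply: (eq_measurable_fun (fun v : 'rV[R]_n => (v ord0 i + z ord0 i : R))).
  by move=> v _; rewrite mxE.
by apply: measurable_funD => //; exact: measurable_coord.
Qed.

(** The measure in dimension n+1 is the image of a product measure under
    [rV_cons], so this is the Tonelli theorem transported along [rV_cons]. *)
Lemma lebesgue_rV_tonelli n (F : 'rV[R]_n.+1 -> \bar R) :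
  measurable_fun setT F -> (forall v, 0 <= F v)%E ->
  (\int[lebesgue_rV n.+1]_v F v =
   \int[mu1]_t \int[lebesgue_rV n]_v F (rV_cons (t, v)))%E.
Proof.
move=> mF F0; have mc := @measurable_rV_cons R n.
rewrite -(@fubini_tonelli1 _ _ _ _ R mu1 (lebesgue_rV n) (F \o @rV_cons R n)).
- by rewrite -[in RHS](preimage_setT (@rV_cons R n)) -ge0_integral_pushforward.
- exact: measurableT_comp mF mc.
- by move=> x; exact: F0.
Qed.

Lemma lebesgue_rV_fubini n (F : 'rV[R]_n.+1 -> \bar R) :
  (lebesgue_rV n.+1).-integrable setT F ->
  (\int[lebesgue_rV n.+1]_v F v =
   \int[mu1]_t \int[lebesgue_rV n]_v F (rV_cons (t, v)))%E.
Proof.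
move=> iF; have mc := @measurable_rV_cons R n.
have mF : measurable_fun setT F by exact: measurable_int iF.
have iFc : (mu1 \x lebesgue_rV n)%E.-integrable setT (F \o @rV_cons R n).
  apply/integrableP; split; first exact: measurableT_comp mF mc.
  move/integrableP : iF => [_]; apply: le_lt_trans.
  rewrite lebesgue_rV_tonelli//; last exact: measurableT_comp.
  rewrite (@fubini_tonelli1 _ _ _ _ R mu1 (lebesgue_rV n) (fun x => `|F (rV_cons x)|%E)) //.
  have mAF : measurable_fun setT (fun v => `|F v|%E) by exact: measurableT_comp.
  exact: measurableT_comp mAF mc.
rewrite (@integral12_prod_meas1 _ _ _ _ R mu1 (lebesgue_rV n) (F \o @rV_cons R n))//.
rewrite -[in RHS](preimage_setT (@rV_cons R n)) -integral_pushforward//.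
Qed.

(** The shifted measure agrees with Lebesgue measure on half-open intervals,
    and these determine it. *)
Lemma lebesgue_measure_shift (a : R) (f : R -> \bar R) :
  measurable_fun setT f -> (forall t, 0 <= f t)%E ->
  (\int[mu1]_t f (t + a)%R = \int[mu1]_t f t)%E.
Proof.
move=> mf f0.
have ms : measurable_fun setT ((fun t => t + a) : measurableTypeR R -> measurableTypeR R).
  exact: measurable_funD.
rewrite -[in LHS](preimage_setT (fun t : R => t + a)).
rewrite -[LHS](@ge0_integral_pushforward _ _ _ _ R _ ms mu1 setT f)//.
apply: eq_measure_integral => A mA _; apply/esym.
apply: (@lebesgue_measure_unique R (pushforward mu1 _)) => //= _ [[x y]] _ <-.
rewrite /pushforward.
have -> : (fun t => t + a) @^-1` `]x, y]%classic = `]x - a, y - a]%classic :> set R.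
  by apply/seteqP; split => t /=; rewrite !in_itv/= ltrBlDr lerBrDr.
rewrite !lebesgue_measure_itv/= !lte_fin ltrD2r; case: ifP => // _.
by rewrite -!EFinB; congr EFin; ring.
Qed.

(** The first coordinate is shifted by the one-dimensional result and the
    others by induction, through iterated integrals. *)
Lemma lebesgue_rV_shift n (a : 'rV[R]_n) (F : 'rV[R]_n -> \bar R) :
  measurable_fun setT F -> (forall v, 0 <= F v)%E ->
  (\int[lebesgue_rV n]_v F (v + a)%R = \int[lebesgue_rV n]_v F v)%E.
Proof.
elim: n a F => [|n IH] a F mF F0.
  by apply: eq_integral => v _; congr F; apply/rowP => -[].
have mc := @measurable_rV_cons R n.
pose a' : 'rV[R]_n := \row_j a ord0 (lift ord0 j).
have shift t v : rV_cons (t, v) + a = rV_cons (t + a ord0 ord0, v + a').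
  apply/rowP => i; rewrite mxE; have [j ->|->] := unliftP ord0 i.
    by rewrite !rV_consS /= !mxE.
  by rewrite !rV_cons0.
rewrite !lebesgue_rV_tonelli//; last first.
  by apply: measurableT_comp => //; exact: measurable_addv.
have mFc : measurable_fun setT (F \o @rV_cons R n) by exact: measurableT_comp.
pose G (t : R) := (\int[lebesgue_rV n]_v F (rV_cons (t, v)))%E.
transitivity (\int[mu1]_t G (t + a ord0 ord0)%R)%E.
  apply: eq_integral => t _; under eq_integral => v _ do rewrite shift.
  apply: (IH a' (fun v => F (rV_cons (t + a ord0 ord0, v)))) => //.
  exact: (@measurable_fun_pair2 _ _ _ _ _ _ (F \o @rV_cons R n)).
apply: (@lebesgue_measure_shift _ G); last first.
  by move=> t; apply: integral_ge0.
apply: (@measurable_fun_fubini_tonelli_F _ _ _ _ R (lebesgue_rV n)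
  (F \o @rV_cons R n)) => //.
by move=> x; exact: F0.
Qed.

Definition box n (s : R) : set 'rV[R]_n := [set v | forall i, `|v ord0 i| <= s].

Lemma measurable_box n s : measurable (@box n s).
Proof.
have -> : @box n s = \bigcap_(i in [set: 'I_n])
    ((fun v : 'rV[R]_n => v ord0 i : R) @^-1` `[- s, s]%classic).
  apply/seteqP; split => v /= h i.
    by move=> _ /=; rewrite in_itv/= -ler_norml.
  by have := h i I; rewrite /= in_itv/= -ler_norml.
apply: fin_bigcap_measurable => // i _.
by rewrite -[X in measurable X]setTI; exact: measurable_coord.
Qed.

Lemma lebesgue_box n s : 0 <= s -> lebesgue_rV n (box s) = ((2 * s) ^+ n)%:E.
Proof.
move=> s0; pose a : 'rV[R]_n := const_mx (- s); pose b : 'rV[R]_n := const_mx s.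
have -> : @box n s = [set v | forall i, v ord0 i \in `[a ord0 i, b ord0 i]].
  by apply/seteqP; split => v /= h i; have := h i; rewrite in_itv/= !mxE -ler_norml.
rewrite lebesgue_rV_box => [|i]; last by rewrite !mxE; lra.
congr EFin; rewrite -[n in RHS]card_ord -prodr_const; apply: eq_bigr => i _.
by rewrite !mxE; ring.
Qed.

Lemma lebesgue_box_lty n s : 0 <= s -> (lebesgue_rV n (box s) < +oo)%E.
Proof. by move=> s0; rewrite lebesgue_box// ltry. Qed.

(** The sigma-algebra is generated by the coordinates, so openness enters
    through a countable base: an open set is the union of the cubes with rational
    centre and radius that it contains. *)
Lemma open_measurable_rV n (A : set 'rV[R]_n) : open A -> measurable A.
Proof.
move=> oA; pose cube (p : 'rV[rat]_n * rat) : set 'rV[R]_n :=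
  \bigcap_(i in [set: 'I_n]) ((fun v => v ord0 i : R) @^-1`
    `]ratr (p.1 ord0 i) - ratr p.2, ratr (p.1 ord0 i) + ratr p.2[%classic).
have -> : A = \bigcup_p (if `[< cube p `<=` A >] then cube p else set0).
  apply/seteqP; split => [x Ax|x [p _]]; last first.
    by case: asboolP => [h /h|].
  have /nbhs_ballP[e /= e0 eA] := oA _ Ax.
  have [r /andP[r0 re]] : exists r : rat, (0 < ratr r :> R) && (ratr r < e / 2).
    have : (0 : R) < e / 2 by lra.
    by move=> /rat_in_itvoo [r]; rewrite in_itv/= => h; exists r.
  have /choice[p hp] : forall i, exists q : rat,
      (x ord0 i - ratr r < ratr q :> R) && (ratr q < x ord0 i + ratr r).
    move=> i; have : x ord0 i - ratr r < x ord0 i + ratr r by lra.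
    by move=> /rat_in_itvoo [q]; rewrite in_itv/= => h; exists q.
  exists (\row_i p i, r) => //; case: asboolP => [_|].
    by move=> i _ /=; rewrite in_itv/= mxE; have /andP[? ?] := hp i; apply/andP; split; lra.
  move=> nc; exfalso; apply: nc => v hv; apply: eA; split => // i j; rewrite ord1.
  have := hv j I; rewrite /= in_itv/= mxE => /andP[h1 h2].
  by have /andP[h3 h4] := hp j; rewrite /ball/= ltr_norml; lra.
apply: countable_bigcupT_measurable; first exact: countableP.
move=> p; case: ifP => // _; apply: fin_bigcap_measurable => // i _.
by rewrite -[X in measurable X]setTI; exact: measurable_coord.
Qed.

End rV_integration.

(** * Preliminaries from real analysis *)

Section trigonometric_bounds.
Context {R : realType}.
Implicit Types x t : R.

Lemma sin_le_abs x : `|sin x| <= `|x|.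
Proof.
wlog x0 : x / 0 <= x => [H|].
  have [/H//|/ltW x0] := leP 0 x.
  by rewrite -normrN -sinN -(normrN x); apply: H; lra.
have dsin y : y \in `]0, x[ -> is_derive y 1 (@sin R) (cos y).
  by move=> _; exact: is_derive_sin.
have csin : {within `[0, x], continuous (@sin R)}.
  by apply: continuous_subspaceT => y; exact: continuous_sin.
have [c _] := MVT_segment x0 dsin csin.
by rewrite sin0 !subr0 => ->; rewrite normrM ler_piMl// cos_max.
Qed.

Lemma cos_ge_half t : `|t| <= 1 -> 1 / 2 <= cos t.
Proof.
move=> t1; have := sin_le_abs (t / 2).
have -> : cos t = 1 - 2 * sin (t / 2) ^+ 2.
  have {1}-> : t = (t / 2) *+ 2 by rewrite -mulr_natr divfK.
  by rewrite cos_mulr2n cos2sin2; ring.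
rewrite normrM (ger0_norm (_ : 0 <= 2^-1))// -(real_normK (num_real (sin _))).
set y := `|sin (t / 2)|; have y0 : 0 <= y by rewrite normr_ge0. move=> yt.
have : y ^+ 2 <= (1 / 2) ^+ 2 by rewrite lerXn2r ?nnegrE//; lra.
by rewrite expr_div_n; lra.
Qed.

End trigonometric_bounds.

Lemma Rintegral_FTC {R : realType} (f F : R -> R) (a b : R) : a < b ->
  (forall t : R, is_derive t 1 F (f t)) -> continuous f ->
  \int[lebesgue_measure]_(t in `[a, b]) f t = F b - F a.
Proof.
move=> ab dF cf; have cF : continuous F.
  move=> t; apply/differentiable_continuous/derivable1_diffP.
  exact: (@ex_derive _ _ _ _ _ _ _ (dF t)).
rewrite /Rintegral (@continuous_FTC2 R f F)//.
- exact: continuous_subspaceT.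
- split => [x _||].
  + exact: (@ex_derive _ _ _ _ _ _ _ (dF x)).
  + exact: cvg_at_right_filter (cF a).
  + exact: cvg_at_left_filter (cF b).
- by move=> x _; rewrite derive1E (@derive_val _ _ _ _ _ _ _ (dF x)).
Qed.

Lemma Rintegral_sum {d} {T : measurableType d} {R : realType}
    (mu : {measure set T -> \bar R}) (I : finType) (D : set T) (f : I -> T -> R) :
  measurable D -> (forall i, mu.-integrable D (EFin \o f i)) ->
  \int[mu]_(x in D) (\sum_i f i x) = \sum_i \int[mu]_(x in D) f i x.
Proof.
move=> mD fi; rewrite /Rintegral.
under eq_integral => x _ do rewrite -sumEFin.
rewrite (integral_sum mD (f := fun i => EFin \o f i))// -sum_fine// => i _.
exact: integrable_fin_num (fi i).
Qed.

(** * A window with an elementary Fourier transform *)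

Section window.
Context {R : realType}.
Local Notation mu1 := (@lebesgue_measure R).
Variable s : R.
Hypothesis s0 : 0 < s.
Implicit Types t z phi : R.

(** The Epanechnikov window. It is continuous and vanishes at the ends of its
    support, so its Fourier transform decays quadratically; an indicator function
    would only give the rate 1/z, which is not summable over the points. *)
Definition window t : R := Num.max 0 (1 - (t / s) ^+ 2).

(** Two integrations by parts; the value at 0 is the integral of the window. *)
Definition window_ft z : R :=
  if z == 0 then 4 / 3 * s
  else 4 * sin (s * z) / (s ^+ 2 * z ^+ 3) - 4 * cos (s * z) / (s * z ^+ 2).

Lemma window_ge0 t : 0 <= window t.
Proof. by rewrite /window le_max lexx. Qed.

Lemma window_le1 t : window t <= 1.
Proof. by rewrite /window ge_max ler01 /= gerBl sqr_ge0. Qed.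

Lemma measurable_window : measurable_fun setT window.
Proof.
apply: measurable_maxr => //; apply: measurable_funB => //.
by apply: measurable_funX; apply: measurable_funM.
Qed.

Lemma windowE t :
  window t = if `|t| <= s then 1 - (t / s) ^+ 2 else 0.
Proof.
have e : (t / s) ^+ 2 = (`|t| / s) ^+ 2.
  by rewrite !expr_div_n real_normK// num_real.
rewrite /window e; case: ifPn => ts.
  rewrite (max_idPr _)// subr_ge0 exprn_ile1//; first by rewrite divr_ge0// ltW.
  by rewrite ler_pdivrMr ?mul1r.
rewrite (max_idPl _)// subr_le0 exprn_ege1// ler_pdivlMr// mul1r.
by rewrite ltW// ltNge.
Qed.

Lemma window_itvE (f : R -> R) :
  (fun t => window t * f t) =
  (fun t => (1 - (t / s) ^+ 2) * f t) \_ `[- s, s]%classic.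
Proof.
apply/funext => t; rewrite windowE /patch.
have -> : (t \in `[- s, s]%classic) = (`|t| <= s).
  by rewrite mem_setE in_itv/= ler_norml.
by case: ifP => // _; rewrite mul0r.
Qed.

Lemma integrable_window : mu1.-integrable setT (EFin \o window).
Proof.
have := @integrable_indic_itv R (- s) s true false.
apply: le_integrable => //.
  by apply/measurable_EFinP; exact: measurable_window.
move=> t _ /=; rewrite lee_fin windowE indicE mem_setE in_itv/= -ler_norml.
case: ifP => //= ts; rewrite ?normr0// normr1 ger0_norm ?gerBl ?sqr_ge0//.
by have := window_ge0 t; rewrite windowE ts.
Qed.

Lemma integrable_windowM (f : R -> R) : measurable_fun setT f ->
  (forall t, `|f t| <= 1) ->
  mu1.-integrable setT (fun t => (window t * f t)%:E).
Proof.
move=> mf f1; apply: le_integrable integrable_window => //.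
  by apply/measurable_EFinP; apply: measurable_funM => //; exact: measurable_window.
move=> t _ /=; rewrite lee_fin normrM ler_piMr//.
Qed.

(** The phase [phi] is what makes the formula usable coordinate by coordinate
    in higher dimension; the sine part of the integral vanishes by parity. *)
Lemma Rintegral_window_cos z phi :
  \int[mu1]_t (window t * cos (t * z + phi)) = window_ft z * cos phi.
Proof.
have sN0 : s != 0 by rewrite gt_eqF.
rewrite window_itvE -Rintegral_mkcond.
have cf : continuous (fun t => (1 - (t / s) ^+ 2) * cos (t * z + phi)).
  move=> t; apply: cvgM.
    by apply: cvgB; [exact: cvg_cst|apply: cvgM; apply: cvgMl; exact: cvg_id].
  apply: (@continuous_comp _ _ _ (fun t => t * z + phi) (@cos R)).
    by apply: cvgD; [apply: cvgMl; exact: cvg_id|exact: cvg_cst].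
  exact: continuous_cos.
have ss : - s < s by rewrite gtrN.
rewrite /window_ft; case: eqVneq => [ze|z0].
  rewrite {}ze in cf *.
  have dF (t : R) : is_derive t 1 (fun t => cos phi * t - cos phi / (3 * s ^+ 2) * t ^+ 3)
      ((1 - (t / s) ^+ 2) * cos (t * 0 + phi)).
    apply: is_derive_eq.
    by rewrite mulr0 add0r /GRing.scale/=; field.
  by rewrite (Rintegral_FTC ss dF cf); field.
have dF (t : R) : is_derive t 1 (fun t => (1 - (t / s) ^+ 2) * sin (t * z + phi) / z
   - 2 * t / s ^+ 2 * cos (t * z + phi) / z ^+ 2 + 2 / (s ^+ 2 * z ^+ 3) * sin (t * z + phi))
      ((1 - (t / s) ^+ 2) * cos (t * z + phi)).
  apply: is_derive_eq.
  by rewrite /GRing.scale/=; field; rewrite sN0.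
rewrite (Rintegral_FTC ss dF cf) (_ : - s * z = - (s * z)) ?mulNr//.
rewrite !sinD !cosD sinN cosN; field.
by rewrite z0 sN0.
Qed.

Lemma window_ft0 : window_ft 0 = 4 / 3 * s.
Proof. by rewrite /window_ft eqxx. Qed.

Lemma window_ft_le z : `|window_ft z| <= 4 / 3 * s.
Proof.
have wcos y : mu1.-integrable setT (EFin \o (fun t => window t * cos (t * y + 0))).
  apply: integrable_windowM => [|t]; last exact: cos_max.
  apply: (measurableT_comp (continuous_measurable_fun (@continuous_cos R))).
  by apply: measurable_funD => //; exact: measurable_funM.
have := Rintegral_window_cos z 0; rewrite cos0 mulr1 => <-.
have := Rintegral_window_cos 0 0; rewrite cos0 mulr1 window_ft0 => <-.
apply: le_trans (le_normr_Rintegral _ (wcos z)) _ => //.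
apply: le_Rintegral => //; first exact: integrable_norm (wcos z).
move=> t _; rewrite normrM ger0_norm ?window_ge0// ler_wpM2l ?window_ge0//.
by rewrite mulr0 add0r cos0 cos_max.
Qed.

(** Both terms of [window_ft] are at most 4 / (s z^2), the first one by
    |sin (s z)| <= |s z|. *)
Lemma window_ft_decay z : z != 0 -> `|window_ft z| <= 8 / (s * z ^+ 2).
Proof.
move=> z0; rewrite /window_ft (negbTE z0).
have s2 : s != 0 by rewrite gt_eqF.
have c0 : 0 <= 4 / (s * z ^+ 2) by rewrite divr_ge0// mulr_ge0 ?sqr_ge0// ltW.
apply: le_trans (ler_normB _ _) _.
have -> : 8 / (s * z ^+ 2) = 4 / (s * z ^+ 2) + 4 / (s * z ^+ 2) by field; rewrite z0.
apply: lerD.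
  have -> : 4 * sin (s * z) / (s ^+ 2 * z ^+ 3) = 4 / (s * z ^+ 2) * (sin (s * z) / (s * z)).
    by field; rewrite z0.
  rewrite normrM (ger0_norm c0) ler_piMr//.
  by rewrite normf_div ler_pdivrMr ?mul1r ?sin_le_abs// normr_gt0 mulf_neq0.
by rewrite mulrAC normrM (ger0_norm c0) ler_piMr// cos_max.
Qed.

Definition windowv n (v : 'rV[R]_n) : R := \prod_i window (v ord0 i).

Lemma windowv_ge0 n (v : 'rV[R]_n) : 0 <= windowv v.
Proof. by apply: prodr_ge0 => i _; exact: window_ge0. Qed.

Lemma windowv_le_box n (v : 'rV[R]_n) : windowv v <= \1_(box s) v.
Proof.
rewrite indicE; have [vs|vNs] := pselect (box s v).
  rewrite mem_set// /windowv -[leRHS](@big1_eq R 1 *%R _ (index_enum 'I_n) xpredT).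
  by apply: ler_prod => i _; rewrite window_ge0 window_le1.
have /existsNP[i /negP vi] := vNs.
by rewrite memNset// /windowv (bigD1 i)//= windowE (negbTE vi) mul0r.
Qed.

Lemma measurable_windowv n : measurable_fun setT (@windowv n).
Proof.
apply: measurable_prod => i _.
exact: (measurableT_comp measurable_window (@measurable_coord R n i)).
Qed.

Lemma integrable_windowv n : (lebesgue_rV n).-integrable setT (EFin \o @windowv n).
Proof.
have mB := @measurable_box R n s.
have iB : (lebesgue_rV n).-integrable setT (EFin \o \1_(@box R n s)).
  apply/integrableP; split; first exact/measurable_EFinP.
  under eq_integral => v _ do rewrite gee0_abs ?lee_fin//.
  by rewrite integral_indic// setIT; apply: lebesgue_box_lty; exact: ltW.
apply: le_integrable iB => //; first by apply/measurable_EFinP; exact: measurable_windowv.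
by move=> v _ /=; rewrite lee_fin !ger0_norm ?windowv_ge0 ?windowv_le_box.
Qed.

Lemma integrable_windowvM n (f : 'rV[R]_n -> R) : measurable_fun setT f ->
  (forall v, `|f v| <= 1) ->
  (lebesgue_rV n).-integrable setT (EFin \o (fun v => windowv v * f v)).
Proof.
move=> mf f1; apply: le_integrable (integrable_windowv n) => //.
  by apply/measurable_EFinP; apply: measurable_funM => //; exact: measurable_windowv.
by move=> t _ /=; rewrite lee_fin normrM ler_piMr.
Qed.

Lemma measurable_cos_dotv n (z : 'rV[R]_n) phi :
  measurable_fun setT (fun v : 'rV[R]_n => cos (dotv v z + phi)).
Proof.
apply: (measurableT_comp (continuous_measurable_fun (@continuous_cos R))).
by apply: measurable_funD => //; exact: measurable_dotv.
Qed.

(** The first coordinate is integrated last: for a fixed value t of it, the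
    inner integral is the lower-dimensional one with phase t z_0 + phi. *)
Lemma Rintegral_windowv_cos n (z : 'rV[R]_n) phi :
  \int[lebesgue_rV n]_v (windowv v * cos (dotv v z + phi)) =
  (\prod_i window_ft (z ord0 i)) * cos phi.
Proof.
have icos m (y : 'rV[R]_m) a : (lebesgue_rV m).-integrable setT
    (EFin \o (fun v => windowv v * cos (dotv v y + a))).
  by apply: integrable_windowvM => [|v]; [exact: measurable_cos_dotv|exact: cos_max].
elim: n z phi => [|n IH] z phi.
  rewrite /Rintegral integral_dirac; last 2 first.
  - by [].
  - exact: measurable_int (icos 0 z phi).
  by rewrite diracE mem_set// mul1e /= /windowv /dotv !big_ord0 add0r.
pose z' : 'rV[R]_n := \row_j z ord0 (lift ord0 j).
rewrite /Rintegral lebesgue_rV_fubini; last exact: icos.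
pose P := \prod_i window_ft (z' ord0 i).
have inner (t : R) : (\int[lebesgue_rV n]_v
    (windowv (rV_cons (t, v)) * cos (dotv (rV_cons (t, v)) z + phi))%:E =
    (P * (window t * cos (t * z ord0 ord0 + phi)))%:E)%E.
  transitivity (\int[lebesgue_rV n]_v ((window t)%:E *
      (windowv v * cos (dotv v z' + (t * z ord0 ord0 + phi)))%:E))%E.
    apply: eq_integral => v _; rewrite -EFinM; congr EFin.
    rewrite /windowv big_ord_recl rV_cons0 /= mulrA.
    under eq_bigr => i _ do rewrite rV_consS /=.
    congr (_ * cos _); rewrite /dotv big_ord_recl rV_cons0 /= addrAC [RHS]addrC; congr (_ + _).
    by apply: eq_bigr => i _; rewrite rV_consS /= mxE.
  apply: etrans (integralZl measurableT (icos n z' (t * z ord0 ord0 + phi)) (window t)) _.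
  rewrite -[X in (_ * X)%E]fineK; last exact: integrable_fin_num (icos _ _ _).
  rewrite -/(Rintegral _ _ _) IH -EFinM; congr EFin.
  by rewrite /P; ring.
under eq_integral => t _ do rewrite inner.
rewrite -/(Rintegral _ _ _) RintegralZl//; last first.
  apply: integrable_windowM => [|t]; last exact: cos_max.
  apply: (measurableT_comp (continuous_measurable_fun (@continuous_cos R))).
  by apply: measurable_funD => //; exact: measurable_funM.
rewrite Rintegral_window_cos big_ord_recl /P.
under eq_bigr => i _ do rewrite mxE.
by ring.
Qed.

End window.

(** * A large sieve inequality for separated points *)

Section separated_points.
Context {R : realType}.

(** Separation is measured in the sup norm, which is compatible with cells and
    product windows. *)
Definition separated d n (delta : R) (X : 'I_n -> 'rV[R]_d) : Prop :=
  forall i j, i != j -> exists l, delta <= `|X i ord0 l - X j ord0 l|.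

(** The cell [k, k+1) has index [Posz k] and the cell [-k-1, -k) has index
    [Negz k]; both are at distance k from the origin. *)
Definition cell_gap (m : int) : nat := match m with Posz k | Negz k => k end.

Lemma cell_gap_le (delta x : R) : 0 < delta ->
  delta * (cell_gap (Num.floor (x / delta)))%:R <= `|x|.
Proof.
move=> d0; have /andP[] := floor_itv (x / delta).
rewrite ler_pdivlMr// ltr_pdivrMr//; case: (Num.floor _) => k /= h1 h2.
  by rewrite mulrC (le_trans h1)// ler_norm.
rewrite -normrN (le_trans _ (ler_norm _))//.
have e : (Negz k + 1)%:~R = - k%:R :> R.
  by rewrite NegzE -addn1 PoszD opprD addrNK rmorphN.
by move: h2; rewrite e; lra.
Qed.

(** The truncation at 1 covers the two cells that touch the origin. *)
Definition cell_bound (k : nat) : R := (maxn 1 k)%:R ^- 2.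

Lemma cell_bound_gt0 k : 0 < cell_bound k.
Proof. by rewrite invr_gt0 exprn_gt0// ltr0n leq_max. Qed.

(** Telescoping: (m+1)^-2 <= 1/m - 1/(m+1), and the terms k = 0 and k = 1 are 1. *)
Lemma sum_cell_bound N : \sum_(k < N) cell_bound k <= 3.
Proof.
have H m : \sum_(k < m.+2) cell_bound k <= 3 - 1 / m.+1%:R.
  elim: m => [|m IH].
    by rewrite big_ord_recr big_ord1 /cell_bound /= expr1n !invr1; lra.
  rewrite big_ord_recr /=; apply: le_trans (lerD IH (lexx _)) _.
  rewrite /cell_bound (maxn_idPr _)//.
  have m0 : 0 < m.+1%:R :> R by rewrite ltr0n.
  rewrite -[m.+2%:R]natr1; move: (m.+1%:R : R) m0 => y y0.
  have -> : 3 - 1 / y + (y + 1) ^- 2 = 3 - 1 / (y + 1) - 1 / (y * (y + 1) ^+ 2).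
    by field; rewrite !gt_eqF//; lra.
  by rewrite gerBl divr_ge0// mulr_ge0 ?sqr_ge0//; lra.
case: N => [|[|N]]; first by rewrite big_ord0.
  by rewrite big_ord1 /cell_bound /= expr1n invr1; lra.
by apply: le_trans (H N) _; rewrite gerBl divr_ge0.
Qed.

(** Separated points lie in different cells, so the sum is dominated by the sum
    over all cells. The latter factors over the coordinates, and in each coordinate
    there are two cells for every gap, whence the factor 2 * 3. *)
Lemma sum_cells d n (delta : R) (X : 'I_n -> 'rV[R]_d) i : 0 < delta ->
  separated delta X ->
  \sum_j \prod_l cell_bound (cell_gap (Num.floor ((X j ord0 l - X i ord0 l) / delta)))
   <= 6 ^+ d.
Proof.
move=> d0 sep; pose c j l := Num.floor ((X j ord0 l - X i ord0 l) / delta).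
pose M := \max_j \max_l cell_gap (c j l).
have cM j l : (cell_gap (c j l) <= M)%N.
  by apply: leq_trans (leq_bigmax j); exact: (leq_bigmax l).
(* A cell index is encoded by its sign and its gap. *)
pose code j : {ffun 'I_d -> bool * 'I_M.+1} :=
  [ffun l => (0 <= c j l, inord (cell_gap (c j l)))].
have code_inj : injective code.
  move=> j j' /ffunP e; apply/eqP/contraT => /sep[l].
  have : c j l = c j' l.
    have := e l; rewrite !ffunE => -[e1] /(congr1 (@nat_of_ord M.+1)).
    rewrite !inordK ?ltnS// => e2.
    by case: (c j l) (c j' l) e1 e2 => ? [] ? //= _ ->.
  rewrite /c => e'; have := floor_itv ((X j ord0 l - X i ord0 l) / delta).
  have := floor_itv ((X j' ord0 l - X i ord0 l) / delta); rewrite -e'.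
  move: (Num.floor _) => m; rewrite !ler_pdivlMr// !ltr_pdivrMr// intrD.
  move=> /andP[h1 h2] /andP[h3 h4]; rewrite leNgt ltr_norml => /negP[].
  by apply/andP; split; lra.
pose F (f : {ffun 'I_d -> bool * 'I_M.+1}) := \prod_l cell_bound (f l).2.
have F0 f : 0 <= F f by apply: prodr_ge0 => l _; rewrite ltW// cell_bound_gt0.
have -> : \sum_j \prod_l cell_bound (cell_gap (c j l)) = \sum_j F (code j).
  apply: eq_bigr => j _; apply: eq_bigr => l _.
  by rewrite ffunE /= inordK// ltnS.
rewrite -(big_imset F (in2W code_inj)) /=.
apply: le_trans (_ : _ <= \sum_f F f) _.
  by rewrite [leRHS](bigID (mem (code @: 'I_n))) /= lerDl sumr_ge0.
rewrite /F -(bigA_distr_bigA (fun _ (p : bool * 'I_M.+1) => cell_bound p.2)).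
have -> : 6 ^+ d = \prod_(l < d) 6 :> R by rewrite prodr_const card_ord.
apply: ler_prod => l _; apply/andP; split.
  by apply: sumr_ge0 => p _; rewrite ltW// cell_bound_gt0.
rewrite -(pair_bigA _ (fun (_ : bool) (k : 'I_M.+1) => cell_bound k)) big_bool /=.
by have := sum_cell_bound M.+1; lra.
Qed.

Variables (s delta : R).
Hypothesis s0 : 0 < s.
Hypothesis d0 : 0 < delta.

(** The Fourier transform of the window, normalized to be 1 at the origin. *)
Definition nft z : R := window_ft s z / (4 / 3 * s).

Lemma nft0 : nft 0 = 1.
Proof. by rewrite /nft window_ft0 divff// gt_eqF// mulr_gt0. Qed.

Lemma nftN z : nft (- z) = nft z.
Proof.
rewrite /nft /window_ft oppr_eq0; case: eqVneq => // z0.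
rewrite !mulrN sinN cosN; congr (_ / _); field.
by rewrite z0 gt_eqF.
Qed.

Lemma nft_le1 z : `|nft z| <= 1.
Proof.
have c0 : 0 < 4 / 3 * s by rewrite mulr_gt0.
rewrite normrM (ger0_norm (_ : 0 <= (4 / 3 * s)^-1)) ?invr_ge0 ?(ltW c0)//.
by rewrite ler_pdivrMr// mul1r window_ft_le.
Qed.

Lemma nft_decay z : z != 0 -> `|nft z| <= 6 / (s * z) ^+ 2.
Proof.
move=> z0; have c0 : 0 < 4 / 3 * s by rewrite mulr_gt0.
rewrite normrM (ger0_norm (_ : 0 <= (4 / 3 * s)^-1)) ?invr_ge0 ?(ltW c0)//.
rewrite ler_pdivrMr//; apply: le_trans (window_ft_decay s0 z0) _.
rewrite le_eqVlt; apply/orP; left; apply/eqP; field.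
by rewrite z0 gt_eqF.
Qed.

Lemma nft_cell z : 6 <= (s * delta) ^+ 2 ->
  `|nft z| <= cell_bound (cell_gap (Num.floor (z / delta))).
Proof.
move=> h; have := cell_gap_le z d0; set k := cell_gap _ => kz.
rewrite /cell_bound; case: (posnP k) => [->|k0].
  by rewrite /= expr1n invr1 nft_le1.
rewrite (maxn_idPr _)//.
have kR : 0 < k%:R :> R by rewrite ltr0n.
have z0 : z != 0 by rewrite -normr_gt0 (lt_le_trans _ kz)// mulr_gt0.
apply: le_trans (nft_decay z0) _.
have hz : (s * delta * k%:R) ^+ 2 <= (s * z) ^+ 2.
  rewrite -(real_normK (num_real (s * z))) lerXn2r ?nnegrE ?mulr_ge0 ?(ltW s0) ?(ltW d0)//.
  by rewrite normrM (gtr0_norm s0) -mulrA ler_pM2l.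
rewrite ler_pdivrMr; last by rewrite exprn_even_gt0//= mulf_neq0// gt_eqF.
rewrite [leRHS]mulrC ler_pdivlMr ?exprn_gt0//; apply: le_trans hz.
by rewrite [leRHS]exprMn ler_pM2r ?exprn_gt0.
Qed.

(** The gain over [nft_cell] at distance at least [delta], which makes the
    off-diagonal entries of the Gram matrix small for large s * delta. *)
Lemma nft_cell_far z : 6 <= (s * delta) ^+ 2 -> delta <= `|z| ->
  `|nft z| <= 6 / (s * delta) ^+ 2 * cell_bound (cell_gap (Num.floor (z / delta))).
Proof.
move=> h dz; have := cell_gap_le z d0; set k := cell_gap _ => kz.
have kz' : delta * (maxn 1 k)%:R <= `|z|.
  by rewrite /maxn; case: ifP => // _; rewrite mulr1.
rewrite /cell_bound; move: (maxn 1 k) (leq_maxl 1 k : (0 < maxn 1 k)%N) kz' => m m0 mz.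
have mR : 0 < m%:R :> R by rewrite ltr0n.
have z0 : z != 0 by rewrite -normr_gt0 (lt_le_trans _ mz)// mulr_gt0.
apply: le_trans (nft_decay z0) _.
have hz : (s * delta * m%:R) ^+ 2 <= (s * z) ^+ 2.
  rewrite -(real_normK (num_real (s * z))) lerXn2r ?nnegrE ?mulr_ge0 ?(ltW s0) ?(ltW d0)//.
  by rewrite normrM (gtr0_norm s0) -mulrA ler_pM2l.
rewrite -mulrA -invfM -exprMn ler_pM2l// lef_pV2// posrE.
  by rewrite exprn_even_gt0//= mulf_neq0// gt_eqF.
by rewrite exprn_gt0// !mulr_gt0.
Qed.

(** Distinct points are at distance [delta] in some coordinate; the improved
    bound is used in that coordinate and the plain one in all the others. *)
Lemma offdiag_sum d n (X : 'I_n -> 'rV[R]_d) i :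
  6 <= (s * delta) ^+ 2 -> separated delta X ->
  \sum_(j | j != i) \prod_l `|nft (X j ord0 l - X i ord0 l)| <=
    6 / (s * delta) ^+ 2 * 6 ^+ d.
Proof.
move=> h sep; have eta0 : 0 <= 6 / (s * delta) ^+ 2 by rewrite divr_ge0 ?sqr_ge0.
apply: le_trans (ler_wpM2l eta0 (sum_cells i d0 sep)).
rewrite [X in _ * X](bigD1 i)//= mulrDr -[leLHS]add0r; apply: lerD.
  by rewrite mulr_ge0// prodr_ge0// => l _; rewrite ltW// cell_bound_gt0.
rewrite mulr_sumr; apply: ler_sum => j ji; have [l dl] := sep _ _ ji.
rewrite [leLHS](bigD1 l)//= [X in _ <= _ * X](bigD1 l)//= [leRHS]mulrA.
apply: ler_pM => //.
- by apply: prodr_ge0.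
- exact: nft_cell_far.
- by apply: ler_prod => m _; rewrite normr_ge0 nft_cell.
Qed.

(** The squared modulus of the exponential sum with coefficients [a] and
    frequencies [X], in real form; see [expsum2E]. *)
Definition expsum2 d n (a : 'I_n -> R) (X : 'I_n -> 'rV[R]_d) (w : 'rV[R]_d) : R :=
  \sum_i \sum_j a i * a j * cos (dotv w (X i - X j)).

Definition sqnorm n (a : 'I_n -> R) : R := \sum_i a i ^+ 2.

Lemma sqnorm_ge0 n (a : 'I_n -> R) : 0 <= sqnorm a.
Proof. by apply: sumr_ge0 => i _; exact: sqr_ge0. Qed.

Lemma Rintegral_window_expsum d n (a : 'I_n -> R) (X : 'I_n -> 'rV[R]_d) :
  \int[lebesgue_rV d]_w (windowv s w * expsum2 a X w) =
  (4 / 3 * s) ^+ d * \sum_i \sum_j a i * a j * \prod_l nft (X j ord0 l - X i ord0 l).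
Proof.
have iw (z : 'rV[R]_d) : (lebesgue_rV d).-integrable setT
    (EFin \o (fun w => windowv s w * cos (dotv w z + 0))).
  by apply: (integrable_windowvM s0) => [|v]; [exact: measurable_cos_dotv|exact: cos_max].
transitivity (\int[lebesgue_rV d]_w (\sum_(p : 'I_n * 'I_n)
   (a p.1 * a p.2) * (windowv s w * cos (dotv w (X p.1 - X p.2) + 0)))).
  apply: eq_Rintegral => w _; rewrite /expsum2 pair_bigA mulr_sumr /=.
  by apply: eq_bigr => p _; rewrite addr0; ring.
rewrite Rintegral_sum => [|//|p]; last first.
  have := integrableZl measurableT (a p.1 * a p.2) (iw (X p.1 - X p.2)).
  by apply: eq_integrable => // x _ /=; rewrite EFinM.
rewrite pair_bigA mulr_sumr; apply: eq_bigr => -[i j] _ /=.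
rewrite RintegralZl// (Rintegral_windowv_cos s0) cos0 mulr1 mulrCA; congr (_ * _).
have -> : (4 / 3 * s) ^+ d = \prod_(l < d) (4 / 3 * s) by rewrite prodr_const card_ord.
rewrite -big_split /=; apply: eq_bigr => l _.
have c0 : 4 / 3 * s != 0 by rewrite gt_eqF// mulr_gt0.
by rewrite -nftN opprB /nft !mxE mulrC divfK.
Qed.

(** Schur test: |a_i a_j| <= (a_i^2 + a_j^2) / 2, and every row of the
    symmetric off-diagonal part has absolute sum at most
    6 / (s * delta)^2 * 6^d <= 1/2. *)
Lemma gram_near_identity d n (a : 'I_n -> R) (X : 'I_n -> 'rV[R]_d) :
  12 * 6 ^+ d <= (s * delta) ^+ 2 -> separated delta X ->
  `|\sum_i \sum_j a i * a j * \prod_l nft (X j ord0 l - X i ord0 l) - sqnorm a|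
    <= 1 / 2 * sqnorm a.
Proof.
move=> h sep; pose g i j := \prod_l nft (X j ord0 l - X i ord0 l).
pose G i j := \prod_l `|nft (X j ord0 l - X i ord0 l)|.
have six : 1 <= 6 ^+ d :> R by rewrite exprn_ege1//; lra.
have sd0 : 0 < (s * delta) ^+ 2 by rewrite exprn_gt0// mulr_gt0.
have row i : \sum_(j | j != i) G i j <= 1 / 2.
  apply: le_trans (offdiag_sum i _ sep) _; first lra.
  by rewrite mulrAC ler_pdivrMr//; lra.
have Gsym i j : G i j = G j i.
  by apply: eq_bigr => l _; rewrite -nftN opprB.
have -> : \sum_i \sum_j a i * a j * g i j - sqnorm a =
    \sum_i \sum_(j | j != i) a i * a j * g i j.
  rewrite /sqnorm -sumrB; apply: eq_bigr => i _; rewrite (bigD1 i)//=.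
  have -> : g i i = 1 by apply: big1 => l _; rewrite subrr nft0.
  by rewrite mulr1 -expr2 addrAC subrr add0r.
apply: le_trans (ler_norm_sum _ _ _) _.
apply: le_trans (_ : \sum_i \sum_(j | j != i)
    (a i ^+ 2 / 2 * G i j + a j ^+ 2 / 2 * G i j) <= _).
  apply: ler_sum => i _; apply: le_trans (ler_norm_sum _ _ _) _.
  apply: ler_sum => j _; rewrite !normrM /g normr_prod -mulrDl ler_wpM2r ?prodr_ge0//.
  rewrite -[a i ^+ 2]real_normK ?num_real// -[a j ^+ 2]real_normK ?num_real//.
  by have := sqr_ge0 (`|a i| - `|a j|); move: `|a i| `|a j| => x y; nra.
under eq_bigr => i _ do rewrite big_split /=.
rewrite big_split /= [X in _ + X](exchange_big_dep xpredT)//=.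
rewrite -big_split /= /sqnorm mulr_sumr; apply: ler_sum => i _.
have -> : \sum_(j | i != j) a i ^+ 2 / 2 * G j i = \sum_(j | j != i) a i ^+ 2 / 2 * G i j.
  by apply: eq_big => j; [rewrite eq_sym|rewrite Gsym].
rewrite -!mulr_sumr -mulrDl -splitr mulrC ler_wpM2r ?sqr_ge0//.
Qed.

(** Exponentials with [delta]-separated frequencies are almost orthogonal with
    respect to a window whose width is large compared to 1 / delta. *)
Lemma expsum_window_bounds d n (a : 'I_n -> R) (X : 'I_n -> 'rV[R]_d) :
  12 * 6 ^+ d <= (s * delta) ^+ 2 -> separated delta X ->
  1 / 2 * ((4 / 3 * s) ^+ d * sqnorm a) <=
    \int[lebesgue_rV d]_w (windowv s w * expsum2 a X w) <=
  3 / 2 * ((4 / 3 * s) ^+ d * sqnorm a).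
Proof.
move=> h sep; rewrite Rintegral_window_expsum.
have := gram_near_identity a h sep; rewrite ler_norml.
have : 0 <= (4 / 3 * s) ^+ d by rewrite exprn_ge0// mulr_ge0// ltW.
move: ((4 / 3 * s) ^+ d) (sqnorm a) (\sum_i _) => c q S c0 /andP[h1 h2].
by rewrite !(mulrCA _ c) !ler_wpM2l//; lra.
Qed.

Lemma expsum2E d n (a : 'I_n -> R) (X : 'I_n -> 'rV[R]_d) w :
  expsum2 a X w = (\sum_i a i * cos (dotv w (X i))) ^+ 2 +
                  (\sum_i a i * sin (dotv w (X i))) ^+ 2.
Proof.
rewrite !expr2 !mulr_suml -big_split; apply: eq_bigr => i _ /=.
rewrite !mulr_sumr -big_split; apply: eq_bigr => j _ /=.
have -> : dotv w (X i - X j) = dotv w (X i) - dotv w (X j).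
  by rewrite /dotv -sumrB; apply: eq_bigr => l _; rewrite !mxE; ring.
by rewrite cosB; ring.
Qed.

Lemma expsum2_ge0 d n (a : 'I_n -> R) (X : 'I_n -> 'rV[R]_d) w : 0 <= expsum2 a X w.
Proof. by rewrite expsum2E addr_ge0 ?sqr_ge0. Qed.

Lemma measurable_expsum2 d n (a : 'I_n -> R) (X : 'I_n -> 'rV[R]_d) :
  measurable_fun setT (expsum2 a X).
Proof.
apply: measurable_sum => i; apply: measurable_sum => j; apply: measurable_funM => //.
apply: (eq_measurable_fun (fun w => cos (dotv w (X i - X j) + 0))).
  by move=> w _; rewrite addr0.
exact: measurable_cos_dotv.
Qed.

Lemma expsum2_le d n (a : 'I_n -> R) (X : 'I_n -> 'rV[R]_d) w :
  expsum2 a X w <= \sum_i \sum_j `|a i * a j|.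
Proof.
apply: ler_sum => i _; apply: ler_sum => j _.
by apply: le_trans (ler_norm _) _; rewrite normrM ler_piMr// cos_max.
Qed.

End separated_points.

(** * Energy at low and at high frequencies *)

Section spectral_energy.
Context {R : realType} {d : nat}.
Variables (Phihat : 'rV[R]_d -> R) (tau cPhi CPhi : R).
Hypothesis iPhi : (lebesgue_rV d).-integrable setT (EFin \o Phihat).
Hypothesis c0 : 0 < cPhi.
Hypothesis C0 : 0 < CPhi.
Hypothesis tau0 : d%:R / 2 < tau.
Hypothesis Phi_bnd : forall w, cPhi * (1 + enorm w ^+ 2) `^ (- tau) <= Phihat w /\
             Phihat w <= CPhi * (1 + enorm w ^+ 2) `^ (- tau).

Let mu := lebesgue_rV d : {measure set 'rV[R]_d -> \bar R}.

Lemma tau_gt0 : 0 < tau.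
Proof. by apply: le_lt_trans tau0; rewrite divr_ge0. Qed.

Lemma powR_negS (x y : R) : 0 < x -> x <= y -> y `^ (- tau) <= x `^ (- tau).
Proof.
move=> x0 xy; rewrite !powRN lef_pV2 ?posrE ?powR_gt0//; last exact: lt_le_trans xy.
by apply: ge0_ler_powR => //; rewrite ?nnegrE ?(ltW tau_gt0)// ltW// (lt_le_trans x0).
Qed.

Lemma enormK (w : 'rV[R]_d) : enorm w ^+ 2 = dotv w w.
Proof.
by rewrite sqr_sqrtr// sumr_ge0// => i _; rewrite -expr2 sqr_ge0.
Qed.

Lemma Phihat_ge0 w : 0 <= Phihat w.
Proof. by apply: le_trans (Phi_bnd w).1; rewrite mulr_ge0 ?powR_ge0// ltW. Qed.

Lemma measurable_Phihat : measurable_fun setT Phihat.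
Proof. by apply/measurable_EFinP; exact: measurable_int iPhi. Qed.

Lemma integrable_PhihatM (f : 'rV[R]_d -> R) (M : R) : measurable_fun setT f ->
  (forall w, `|f w| <= M) -> mu.-integrable setT (EFin \o (fun w => Phihat w * f w)).
Proof.
move=> mf fM; have M0 : 0 <= M by exact: le_trans (fM 0).
have := integrableZl measurableT M iPhi; apply: le_integrable => //.
  by apply/measurable_EFinP; apply: measurable_funM => //; exact: measurable_Phihat.
move=> w _ /=; rewrite lee_fin !normrM mulrC ler_wpM2r//.
by rewrite (ger0_norm M0).
Qed.

Variables (n : nat) (a : 'I_n -> R) (X : 'I_n -> 'rV[R]_d) (delta : R).
Hypothesis d0 : 0 < delta.
Hypothesis sep : separated delta X.

Let A2 := expsum2 a X.
Let Amax := \sum_i \sum_j `|a i * a j|.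

Lemma integrable_PhihatA (f : 'rV[R]_d -> R) : measurable_fun setT f ->
  (forall w, `|f w| <= 1) ->
  mu.-integrable setT (EFin \o (fun w => Phihat w * (A2 w * f w))).
Proof.
move=> mf f1; apply: (@integrable_PhihatM _ Amax).
  by apply: measurable_funM => //; exact: measurable_expsum2.
move=> w; rewrite normrM -[Amax]mulr1 ler_pM//.
by rewrite ger0_norm ?expsum2_ge0// expsum2_le.
Qed.

Lemma integrable_PhihatA1 : mu.-integrable setT (EFin \o (fun w => Phihat w * A2 w)).
Proof.
have := @integrable_PhihatA (cst 1) (measurable_cst _).
rewrite (_ : (fun w => Phihat w * (A2 w * cst 1 w)) = (fun w => Phihat w * A2 w)).
  by apply => w; rewrite normr1.
by apply/funext => w; rewrite mulr1.
Qed.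

Lemma integrable_windowA s : 0 < s ->
  mu.-integrable setT (EFin \o (fun w => windowv s w * A2 w)).
Proof.
move=> s0; have := integrableZl measurableT Amax (integrable_windowv s0 d).
apply: le_integrable => //.
  apply/measurable_EFinP; apply: measurable_funM; last exact: measurable_expsum2.
  exact: measurable_windowv.
move=> w _ /=; rewrite lee_fin !normrM mulrC ler_wpM2r//.
by rewrite ger0_norm ?expsum2_ge0// (le_trans (expsum2_le _ _ _))// ler_norm.
Qed.

(** Up to the constant of the inversion formula, the value of the quadratic
    form of the kernel; see [quadratic_form0]. *)
Definition energy : R := \int[mu]_w (Phihat w * A2 w).

(** On the support of the window of width s, [Phihat] is at least its lower
    bound at the corners of the box. *)
Lemma energy_low s : 0 < s -> 12 * 6 ^+ d <= (s * delta) ^+ 2 ->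
  cPhi * (1 + d%:R * s ^+ 2) `^ (- tau) * (1 / 2 * ((4 / 3 * s) ^+ d * sqnorm a)) <= energy.
Proof.
move=> s0 h; set K := cPhi * _.
have K0 : 0 <= K by rewrite mulr_ge0 ?powR_ge0// ltW.
have /andP[lo _] := expsum_window_bounds s0 d0 a h sep.
apply: le_trans (ler_wpM2l K0 lo) _.
rewrite -RintegralZl//; last exact: integrable_windowA.
apply: le_Rintegral => //.
- by have := integrableZl measurableT K (integrable_windowA s0); apply: eq_integrable.
- exact: integrable_PhihatA1.
move=> w _; rewrite mulrA ler_wpM2r ?expsum2_ge0//.
apply: le_trans (ler_wpM2l K0 (windowv_le_box s0 w)) _.
rewrite indicE; case: (boolP (w \in _)) => [|_]; last by rewrite mulr0 Phihat_ge0.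
rewrite inE => ws; rewrite mulr1; apply: le_trans (Phi_bnd w).1.
rewrite ler_wpM2l ?(ltW c0)//; apply: powR_negS.
  by rewrite ltr_pwDl// sqr_ge0.
rewrite lerD2l enormK /dotv.
apply: le_trans (_ : \sum_(i < d) s ^+ 2 <= _).
  apply: ler_sum => i _; rewrite -expr2 -real_normK ?num_real//.
  by rewrite lerXn2r ?nnegrE ?(ltW s0)//; exact: ws.
by rewrite sumr_const card_ord mulr_natl.
Qed.

Definition high_const : R := CPhi * (4 / 3) ^+ d * (3 / 2) * (16 / 3) ^+ d.

Let p := d%:R - 2 * tau.

Lemma dyadic_exp_lt1 : 2 `^ p < 1 :> R.
Proof.
have e0 : 0 < 2 * tau - d%:R by have := tau0; lra.
rewrite /p -opprB powRN invf_lt1 ?powR_gt0//.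
have := @gt0_ltr_powR R _ e0 1 2; rewrite !nnegrE ler01 ler0n powR1; apply => //.
by rewrite ltr1n.
Qed.

(** On the shell [Phihat] is at most CPhi s^(-2 tau), and the window of width
    4 s is at least 3/4 in every coordinate. *)
Lemma shell_integral s : 0 < s -> 12 * 6 ^+ d <= (s * delta) ^+ 2 ->
  (\int[mu]_(w in box (2 * s) `\` box s) (Phihat w * A2 w)%:E <=
    (high_const * s `^ p * sqnorm a)%:E)%E.
Proof.
move=> s0 h; pose S := 4 * s.
have S0 : 0 < S by rewrite mulr_gt0.
have hS : 12 * 6 ^+ d <= (S * delta) ^+ 2.
  apply: le_trans h _; rewrite lerXn2r ?nnegrE ?mulr_ge0 ?(ltW s0) ?(ltW S0) ?(ltW d0)//.
  by rewrite ler_pM2r// /S; lra.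
pose K := CPhi * s `^ (- (2 * tau)) * (4 / 3) ^+ d.
have K0 : 0 <= K by rewrite !mulr_ge0 ?powR_ge0 ?exprn_ge0// ltW.
have /andP[_ hi] := expsum_window_bounds S0 d0 a hS sep.
have mB t : measurable (@box R d t) by exact: measurable_box.
have mPA : measurable_fun setT (fun w => (Phihat w * A2 w)%:E).
  exact: measurable_int integrable_PhihatA1.
have iKW : mu.-integrable setT (fun w => (K * (windowv S w * A2 w))%:E).
  by have := integrableZl measurableT K (integrable_windowA S0); apply: eq_integrable.
apply: (@le_trans _ _ (\int[mu]_w (K * (windowv S w * A2 w))%:E)%E); last first.
  rewrite -[leLHS]fineK; last exact: integrable_fin_num iKW.
  rewrite lee_fin -/(Rintegral _ _ _) RintegralZl//; last exact: integrable_windowA.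
  apply: le_trans (ler_wpM2l K0 hi) _.
  rewrite le_eqVlt; apply/orP; left; apply/eqP.
  rewrite /K /high_const /S /p powRD; last first.
    by rewrite (gt_eqF s0) implybT.
  rewrite powR_mulrn ?(ltW s0)// [4 / 3 * (4 * s)](_ : _ = 16 / 3 * s); last by field.
  by rewrite [(16 / 3 * s) ^+ d]exprMn; ring.
apply: (@le_trans _ _ (\int[mu]_(w in box (2 * s) `\` box s)
    (K * (windowv S w * A2 w))%:E)%E); last first.
  apply: ge0_subset_integral => //; first exact: measurableD.
    exact: measurable_int iKW.
  by move=> w Fw; rewrite lee_fin mulr_ge0// mulr_ge0 ?windowv_ge0 ?expsum2_ge0.
apply: ge0_le_integral => //.
- exact: measurableD.
- by move=> w Fw; rewrite lee_fin mulr_ge0 ?Phihat_ge0 ?expsum2_ge0.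
- exact: measurable_funS mPA.
- by apply: measurable_funS (measurable_int _ iKW).
move=> w [w2s /existsNP[l /negP wl]]; rewrite lee_fin mulrA ler_wpM2r ?expsum2_ge0//.
apply: le_trans (Phi_bnd w).2 _; rewrite /K -!mulrA ler_pM2l//.
have hW : 1 <= (4 / 3) ^+ d * windowv S w.
  have -> : (4 / 3) ^+ d = \prod_(l < d) (4 / 3) :> R by rewrite prodr_const card_ord.
  rewrite /windowv -big_split /=.
  rewrite -[leLHS](@big1_eq R 1 *%R _ (index_enum 'I_d) xpredT).
  apply: ler_prod => i _; rewrite ler01 /= windowE//.
  have wi := w2s i; rewrite ifT; last by apply: le_trans wi _; rewrite /S; lra.
  have : (w ord0 i / S) ^+ 2 <= (1 / 2) ^+ 2.
    rewrite -real_normK ?num_real// lerXn2r ?nnegrE// normrM (ger0_norm (_ : 0 <= S^-1)).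
      by rewrite ler_pdivrMr// /S; lra.
    by rewrite invr_ge0 ltW.
  by rewrite expr_div_n; lra.
apply: le_trans (_ : s `^ (- (2 * tau)) <= _); last by rewrite ler_peMr// powR_ge0.
have -> : s `^ (- (2 * tau)) = (s ^+ 2) `^ (- tau).
  by rewrite -powR_mulrn ?(ltW s0)// -powRrM mulrN.
apply: powR_negS; first by rewrite exprn_gt0.
rewrite enormK /dotv (bigD1 l)//=.
have w2 : s ^+ 2 <= w ord0 l * w ord0 l.
  rewrite -expr2 -[leRHS]real_normK ?num_real//.
  by rewrite lerXn2r ?nnegrE ?(ltW s0)// ltW// ltNge.
rewrite -[leLHS]add0r lerD// -[leLHS]addr0 lerD//.
by apply: sumr_ge0 => i _; rewrite -expr2 sqr_ge0.
Qed.

(** The complement of the box is the disjoint union of the shells of sizes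
    2^k s, whose contributions are bounded by a geometric progression of ratio
    2^(d - 2 tau). *)
Lemma energy_high s : 0 < s -> 12 * 6 ^+ d <= (s * delta) ^+ 2 ->
  \int[mu]_(w in ~` box s) (Phihat w * A2 w) <=
    high_const * s `^ p / (1 - 2 `^ p) * sqnorm a.
Proof.
move=> s0 h; pose r : R := 2 `^ p; pose C := high_const * s `^ p * sqnorm a.
have r0 : 0 <= r by rewrite powR_ge0.
have r1 : r < 1 by exact: dyadic_exp_lt1.
have C1 : 0 <= C.
  rewrite !mulr_ge0 ?powR_ge0 ?sqnorm_ge0 ?exprn_ge0//; exact: ltW.
pose F k := @box R d (2 * (2 ^+ k * s)) `\` box (2 ^+ k * s).
have mF k : measurable (F k) by apply: measurableD; exact: measurable_box.
have box_mono t t' : t <= t' -> @box R d t `<=` box t'.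
  by move=> tt w wt i; exact: le_trans (wt i) tt.
have powS k : 2 * (2 ^+ k * s) = 2 ^+ k.+1 * s by rewrite exprS mulrA.
have pow_mono k k' : (k <= k')%N -> 2 ^+ k * s <= 2 ^+ k' * s.
  by move=> kk; rewrite ler_pM2r// ler_weXn2l//; lra.
have UF : ~` box s = \bigcup_k F k.
  apply/seteqP; split => [w ws|w [k _ [_ wk]] ws]; last first.
    by apply/wk/(box_mono _ _ _ _ ws); rewrite ler_peMl ?(ltW s0)// exprn_ege1//; lra.
  have [N wN] : exists N, box (2 ^+ N * s) w.
    pose M := \sum_i `|w ord0 i|.
    exists (Num.bound (M / s)) => i; apply: (@le_trans _ _ M).
      by rewrite /M (bigD1 i)//= lerDl sumr_ge0.
    rewrite -ler_pdivrMr//; apply: ltW; apply: lt_le_trans (archi_boundP _) _.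
      by rewrite divr_ge0 ?(ltW s0)// sumr_ge0.
    by rewrite -natrX ler_nat ltnW// ltn_expl.
  (* The shell of w is the last one before the first box that contains w. *)
  have /ex_minnP[m wm mmin] : exists N, `[< box (2 ^+ N * s) w >].
    by exists N; exact/asboolP.
  case: m wm mmin => [|m] /asboolP wm mmin; first by move: wm; rewrite expr0 mul1r => /ws.
  exists m => //; split; first by rewrite powS.
  by move/asboolP/mmin; rewrite ltnn.
have tF : trivIset setT F.
  apply/trivIsetP => i j _ _; wlog ij : i j / (i < j)%N => [H|_].
    rewrite neq_ltn => /orP[] ij; [|rewrite setIC]; apply: H => //.
      by rewrite ltn_eqF.
    by rewrite ltn_eqF.
  apply/seteqP; split => // w [[wi _] [_ wj]]; apply: wj.
  by apply: box_mono wi; rewrite powS; exact: pow_mono.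
have mPA : measurable_fun setT (fun w => (Phihat w * A2 w)%:E).
  exact: measurable_int integrable_PhihatA1.
have PA0 w : (0 <= (Phihat w * A2 w)%:E)%E.
  by rewrite lee_fin mulr_ge0 ?Phihat_ge0 ?expsum2_ge0.
suff : (\int[mu]_(w in ~` box s) (Phihat w * A2 w)%:E <= (C / (1 - r))%:E)%E.
  move=> H; have -> : high_const * s `^ p / (1 - 2 `^ p) * sqnorm a = C / (1 - r).
    by rewrite /C -/r; ring.
  rewrite -lee_fin fineK//; apply/fin_real/andP; split.
    by rewrite (lt_le_trans _ (integral_ge0 _ _))// ltNye.
  by rewrite (le_lt_trans H)// ltry.
have term k : (\int[mu]_(w in F k) (Phihat w * A2 w)%:E <= (C * r ^+ k)%:E)%E.
  have t0 : 0 < 2 ^+ k * s by rewrite mulr_gt0 ?exprn_gt0.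
  have := shell_integral t0; rewrite -/(F k) => H; apply: le_trans (H _) _.
    apply: le_trans h _; rewrite lerXn2r ?nnegrE ?mulr_ge0 ?(ltW s0) ?(ltW t0) ?(ltW d0)//.
    by rewrite ler_pM2r// ler_peMl ?(ltW s0)// exprn_ege1//; lra.
  have e : (2 ^+ k) `^ p = r ^+ k :> R.
    by rewrite -powR_mulrn// -powRrM mulrC powRrM powR_mulrn ?powR_ge0.
  rewrite lee_fin powRM ?exprn_ge0 ?(ltW s0)// e /C.
  by rewrite le_eqVlt; apply/orP; left; apply/eqP; ring.
have geo m : \sum_(0 <= k < m) C * r ^+ k = C * (1 - r ^+ m) / (1 - r).
  elim: m => [|m IH]; first by rewrite big_nil expr0 subrr mulr0 mul0r.
  rewrite big_nat_recr//= IH exprS; field.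
  by rewrite subr_eq0 gt_eqF.
rewrite UF ge0_integral_bigcup//; last exact: measurable_funS mPA.
apply: lime_le; first by apply: is_cvg_nneseries => k _ _; exact: integral_ge0.
near=> m; apply: (@le_trans _ _ (\sum_(0 <= k < m) (C * r ^+ k)%:E)%E).
  by apply: lee_sum => k _; exact: term.
rewrite sumEFin lee_fin geo ler_pM2r ?invr_gt0 ?subr_gt0// ler_piMr//.
by rewrite gerBl exprn_ge0.
Unshelve. all: by end_near. Qed.

End spectral_energy.

(** * Shifted quadratic forms *)

Lemma dotvDr {R : realType} {d : nat} (w x y : 'rV[R]_d) :
  dotv w (x + y) = dotv w x + dotv w y.
Proof. by rewrite /dotv -big_split; apply: eq_bigr => l _; rewrite !mxE mulrDr. Qed.

Lemma dotvNr {R : realType} {d : nat} (w x : 'rV[R]_d) : dotv w (- x) = - dotv w x.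
Proof. by rewrite /dotv -sumrN; apply: eq_bigr => l _; rewrite !mxE mulrN. Qed.

Lemma measurable_cosv {R : realType} {d : nat} (z : 'rV[R]_d) :
  measurable_fun setT (fun v : 'rV[R]_d => cos (dotv v z)).
Proof.
apply: (eq_measurable_fun (fun w => cos (dotv w z + 0))).
  by move=> w _; rewrite addr0.
exact: measurable_cos_dotv.
Qed.

Section shifted_form.
Context {R : realType} {d : nat}.
Variables (Phi Phihat : 'rV[R]_d -> R) (tau cPhi CPhi : R).
Hypothesis FT : fourier_transform_of Phi Phihat.
Hypothesis c0 : 0 < cPhi.
Hypothesis C0 : 0 < CPhi.
Hypothesis tau0 : d%:R / 2 < tau.
Hypothesis Phi_bnd : forall w, cPhi * (1 + enorm w ^+ 2) `^ (- tau) <= Phihat w /\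
             Phihat w <= CPhi * (1 + enorm w ^+ 2) `^ (- tau).

Let mu := lebesgue_rV d : {measure set 'rV[R]_d -> \bar R}.
Let iPhi : mu.-integrable setT (EFin \o Phihat) := FT.1.

Definition fourier_const : R := (2 * pi) `^ (- (d%:R / 2)).

Lemma fourier_const_gt0 : 0 < fourier_const.
Proof. by rewrite powR_gt0// mulr_gt0// pi_gt0. Qed.

Lemma PhiE x : Phi x = fourier_const * \int[mu]_w (Phihat w * cos (dotv w x)).
Proof.
have [_ /(_ x) /(congr1 (@complex.Re R))] := FT.
rewrite /cintegral /expi /= mul0r subr0 => ->; congr (_ * _).
by apply: eq_Rintegral => w _; rewrite mul0r subr0.
Qed.

Lemma integrable_Phihat_cos z :
  mu.-integrable setT (EFin \o (fun w => Phihat w * cos (dotv w z))).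
Proof.
apply: (@integrable_PhihatM _ _ Phihat iPhi _ 1); first exact: measurable_cosv.
by move=> w; exact: cos_max.
Qed.

Variables (n : nat) (a : 'I_n -> R) (X : 'I_n -> 'rV[R]_d).

(** Exchanging i and j changes the sign of the sine. *)
Lemma expsum_antisym w :
  \sum_i \sum_j a i * a j * sin (dotv w (X i - X j)) = 0.
Proof.
set S := (X in X = 0); suff : S *+ 2 = 0 by move/eqP; rewrite mulrn_eq0 => /eqP.
rewrite /S mulr2n.
rewrite [X in X + _ = _]exchange_big /= -big_split; apply: big1 => i _ /=.
rewrite -big_split; apply: big1 => j _ /=.
by rewrite -opprB dotvNr sinN; ring.
Qed.

(** By the addition formula, cos (w . (x_i - x_j + u)) splits into a term with
    cos (w . u), which gives the right-hand side, and an antisymmetric term. *)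
Lemma quadratic_formE (u : 'rV[R]_d) :
  \sum_i \sum_j a i * a j * Phi (X i - X j + u) =
  fourier_const * \int[mu]_w (Phihat w * (expsum2 a X w * cos (dotv w u))).
Proof.
transitivity (fourier_const * \int[mu]_w (\sum_(p : 'I_n * 'I_n)
   (a p.1 * a p.2) * (Phihat w * cos (dotv w (X p.1 - X p.2 + u))))); last first.
  congr (_ * _); apply: eq_Rintegral => w _.
  rewrite -(pair_bigA _ (fun i j => a i * a j * (Phihat w * cos (dotv w (X i - X j + u))))) /=.
  transitivity (Phihat w * (\sum_i \sum_j a i * a j * cos (dotv w (X i - X j + u)))).
    rewrite mulr_sumr; apply: eq_bigr => i _; rewrite mulr_sumr.
    by apply: eq_bigr => j _; ring.
  congr (_ * _); rewrite -[RHS]subr0 -[X in _ = _ - X](mul0r (sin (dotv w u))).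
  rewrite -[X in _ = _ - X * _](expsum_antisym w) /expsum2.
  rewrite !mulr_suml -sumrB; apply: eq_bigr => i _.
  rewrite !mulr_suml -sumrB; apply: eq_bigr => j _.
  by rewrite dotvDr cosD; ring.
rewrite Rintegral_sum => [|//|p]; last first.
  have := integrableZl measurableT (a p.1 * a p.2) (integrable_Phihat_cos (X p.1 - X p.2 + u)).
  by apply: eq_integrable => // x _ /=; rewrite EFinM.
rewrite pair_bigA mulr_sumr; apply: eq_bigr => -[i j] _ /=.
by rewrite RintegralZl// ?PhiE; [ring|exact: integrable_Phihat_cos].
Qed.

Lemma quadratic_form0 :
  \sum_i \sum_j a i * a j * Phi (X i - X j) = fourier_const * energy Phihat a X.
Proof.
have := quadratic_formE 0.
under eq_bigr => i _ do under eq_bigr => j _ do rewrite addr0.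
move=> ->; congr (_ * _); apply: eq_Rintegral => w _.
by rewrite [dotv w 0]big1 ?cos0 ?mulr1// => l _; rewrite mxE mulr0.
Qed.

(** On the box, cos (w . u) >= 1/2; outside it, cos (w . u) >= -1. The total
    is at least half of the energy minus 3/2 of its high-frequency part, that is
    (1/2 - 3/2 * 1/6) = 1/4 of the energy. *)
Lemma shifted_energy (s : R) (u : 'rV[R]_d) : 0 < s ->
  (forall l, `|u ord0 l| * (d%:R * s) <= 1) ->
  \int[mu]_(w in ~` box s) (Phihat w * expsum2 a X w) <= energy Phihat a X / 6 ->
  energy Phihat a X / 4 <=
    \int[mu]_w (Phihat w * (expsum2 a X w * cos (dotv w u))).
Proof.
move=> s0 us hi; pose PA w := Phihat w * expsum2 a X w.
have P0 := Phihat_ge0 c0 Phi_bnd.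
have PA0 w : 0 <= PA w by rewrite mulr_ge0 ?expsum2_ge0.
have iPA := @integrable_PhihatA1 _ _ Phihat iPhi _ a X.
have mB : measurable (~` @box R d s) by apply: measurableC; exact: measurable_box.
pose h := PA \_ (~` @box R d s).
have ih : mu.-integrable setT (EFin \o h).
  by rewrite -restrict_EFin; apply/(integrable_mkcond _ mB); exact: integrableS iPA.
have -> : energy Phihat a X / 4 = 1 / 2 * \int[mu]_w PA w -
    3 / 2 * (energy Phihat a X / 6) by rewrite /energy; field.
apply: (@le_trans _ _ (1 / 2 * \int[mu]_w PA w - 3 / 2 * \int[mu]_w h w)).
  by rewrite lerD2l lerN2 ler_wpM2l// /h -Rintegral_mkcond.
rewrite -!RintegralZl// -RintegralB//; last 2 first.
- by have := integrableZl measurableT (1 / 2) iPA; apply: eq_integrable.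
- by have := integrableZl measurableT (3 / 2) ih; apply: eq_integrable.
apply: le_Rintegral => //.
- have i1 := integrableZl measurableT (1 / 2) iPA.
  have i2 := integrableZl measurableT (3 / 2) ih.
  by have := integrableB measurableT i1 i2; apply: eq_integrable.
- apply: integrable_PhihatA => //; first exact: measurable_cosv.
  by move=> w; exact: cos_max.
move=> w _; rewrite mulrA -/(PA w) /h /patch.
case: ifPn => [_|].
  by have := cos_geN1 (dotv w u); have := PA0 w; nra.
rewrite in_setC negbK inE => ws; rewrite mulr0 subr0 mulrC ler_wpM2l//.
apply: cos_ge_half; apply: le_trans (ler_norm_sum _ _ _) _.
apply: (@le_trans _ _ (\sum_(l < d) d%:R^-1)).
  apply: ler_sum => l _; rewrite normrM.
  have dd : 0 < d%:R :> R by rewrite ltr0n (leq_ltn_trans _ (ltn_ord l)).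
  rewrite -[leRHS]mul1r ler_pdivlMr//; apply: le_trans (us l).
  rewrite [leLHS](_ : _ = `|u ord0 l| * (d%:R * `|w ord0 l|)); last by ring.
  by rewrite !ler_wpM2l//; exact: ws.
rewrite sumr_const card_ord -(mulr_natr d%:R^-1).
by have [->|dd] := eqVneq d 0%N; rewrite ?mulr0// mulVf ?pnatr_eq0.
Qed.

End shifted_form.

(** * The smallest eigenvalue as a minimal Rayleigh quotient *)

Section rayleigh.
Context {R : realType} {n : nat}.
Variable A : 'M[R]_n.
Hypothesis symA : A^T = A.
Implicit Types (v w : 'rV[R]_n).

Definition qform v : R := \sum_i \sum_j v ord0 i * v ord0 j * A i j.

Lemma coord_cont (i : 'I_n) : continuous (fun v => v ord0 i : R).
Proof. exact: coord_continuous. Qed.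

Lemma qform_continuous : continuous qform.
Proof.
apply: (@continuous_big R 'I_n +%R 0 xpredT); first exact: add_continuous.
move=> i _; apply: (@continuous_big R 'I_n +%R 0 xpredT); first exact: add_continuous.
move=> j _ v; exact: (cvgM (cvgM (@coord_cont i v) (@coord_cont j v)) (cvg_cst (A i j))).
Qed.

Lemma dotv_continuous : continuous (fun v => dotv v v).
Proof.
apply: (@continuous_big R 'I_n +%R 0 xpredT); first exact: add_continuous.
by move=> j _ v; exact: (cvgM (@coord_cont j v) (@coord_cont j v)).
Qed.

Lemma dotvv_ge0 v : 0 <= dotv v v.
Proof. by apply: sumr_ge0 => i _; rewrite -expr2 sqr_ge0. Qed.

Lemma dotvv_eq0 v : dotv v v = 0 -> v = 0.
Proof.
move=> h; apply/rowP => i; rewrite mxE; apply/eqP; rewrite -sqrf_eq0 expr2.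
have := psumr_eq0P (P := xpredT) (F := fun i => v ord0 i * v ord0 i) _ h (i := i) isT.
by move=> ->// j _; rewrite -expr2 sqr_ge0.
Qed.

Lemma compact_sphere : compact [set v : 'rV[R]_n | dotv v v = 1].
Proof.
apply: bounded_closed_compact; last first.
  have := (continuous_closedP _).1 dotv_continuous [set 1].
  by apply; exact: closed_eq.
exists 1; split => // M M1 v /= v1; apply: le_trans (ltW M1).
rewrite [leLHS]/Num.norm /= mx_normrE; apply/bigmax_leP; split => // -[i j] _ /=.
rewrite ord1 -(@expr_le1 _ 2)// real_normK ?num_real//.
rewrite -v1 /dotv (bigD1 j)//= expr2 lerDl.
by apply: sumr_ge0 => k _; rewrite -expr2 sqr_ge0.
Qed.

(** A quadratic form attains its minimum on the compact unit sphere, and both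
    sides of the inequality are homogeneous of degree 2. *)
Lemma rayleigh_min : (0 < n)%N ->
  exists2 c, dotv c c = 1 & forall v, qform c * dotv v v <= qform v.
Proof.
move=> n0; have S0 : [set v : 'rV[R]_n | dotv v v = 1] !=set0.
  exists (delta_mx ord0 (Ordinal n0)); rewrite /= /dotv (bigD1 (Ordinal n0))//=.
  rewrite !mxE !eqxx mulr1 big1 ?addr0// => i i0.
  by rewrite !mxE (negbTE i0) andbF mulr0.
have [|c c1 cmin] := EVT_min_rV S0 compact_sphere (f := qform).
  exact/continuous_subspaceT/qform_continuous.
exists c; first by move: c1; rewrite inE.
move=> v; have [v0|v0] := eqVneq (dotv v v) 0.
  rewrite v0 mulr0 (dotvv_eq0 v0) /qform big1// => i _.
  by rewrite big1// => j _; rewrite mxE !mul0r.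
have vp : 0 < dotv v v by rewrite lt_neqAle eq_sym v0 dotvv_ge0.
pose t := (Num.sqrt (dotv v v))^-1.
have t2 : t ^+ 2 = (dotv v v)^-1 by rewrite exprVn sqr_sqrtr// ltW.
have tv1 : dotv (t *: v) (t *: v) = 1.
  transitivity (t ^+ 2 * dotv v v); last by rewrite t2 mulVf.
  by rewrite /dotv mulr_sumr; apply: eq_bigr => i _; rewrite !mxE; ring.
have := cmin (t *: v); rewrite inE => /(_ tv1).
have -> : qform (t *: v) = t ^+ 2 * qform v.
  rewrite /qform mulr_sumr; apply: eq_bigr => i _; rewrite mulr_sumr.
  by apply: eq_bigr => j _; rewrite !mxE; ring.
by rewrite t2 mulrC ler_pdivlMr.
Qed.

(** First variation: along the ray c + t g in the direction of the residual g,
    the nonnegative function qform v - qform c * |v|^2 equals 2 t |g|^2 + t^2 D, so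
    |g|^2 must vanish. *)
Lemma rayleigh_eigen c : dotv c c = 1 -> (forall v, qform c * dotv v v <= qform v) ->
  c *m A = qform c *: c.
Proof.
move=> c1 cmin; pose g : 'rV[R]_n := c *m A - qform c *: c.
have cross : \sum_i \sum_j c ord0 i * g ord0 j * A i j - qform c * dotv c g = dotv g g.
  rewrite exchange_big /= /dotv mulr_sumr -sumrB; apply: eq_bigr => j _.
  have -> : \sum_i c ord0 i * g ord0 j * A i j = g ord0 j * (c *m A) ord0 j.
    by rewrite [(c *m A) ord0 j]mxE mulr_sumr; apply: eq_bigr => i _; ring.
  have -> : (c *m A) ord0 j = g ord0 j + qform c * c ord0 j by rewrite !mxE; ring.
  by ring.
have expand t : qform (c + t *: g) - qform c * dotv (c + t *: g) (c + t *: g) =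
    2 * t * dotv g g + t ^+ 2 * (qform g - qform c * dotv g g).
  have -> : dotv (c + t *: g) (c + t *: g) = dotv c c + 2 * t * dotv c g + t ^+ 2 * dotv g g.
    rewrite /dotv !mulr_sumr -!big_split; apply: eq_bigr => i _ /=.
    by rewrite [(c + t *: g) ord0 i]mxE [(t *: g) ord0 i]mxE; ring.
  have -> : qform (c + t *: g) = qform c +
      2 * t * (\sum_i \sum_j c ord0 i * g ord0 j * A i j) + t ^+ 2 * qform g.
    have sw : \sum_i \sum_j g ord0 i * c ord0 j * A i j =
        \sum_i \sum_j c ord0 i * g ord0 j * A i j.
      rewrite exchange_big /=; apply: eq_bigr => i _; apply: eq_bigr => j _.
      by have -> : A j i = A i j by [rewrite -{1}symA mxE]; ring.
    rewrite mulr2n mulrDl mul1r mulrDl -{1}sw /qform !mulr_sumr -!big_split.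
    apply: eq_bigr => i _ /=; rewrite !mulr_sumr -!big_split; apply: eq_bigr => j _ /=.
    by rewrite ![(c + t *: g) ord0 _]mxE ![(t *: g) ord0 _]mxE; ring.
  by rewrite -cross c1; ring.
suff : g = 0 by move/subr0_eq.
apply: dotvv_eq0; set G := dotv g g in expand *; set D := qform g - _ in expand.
have D0 : 0 <= D by rewrite subr_ge0 cmin.
have G0 : 0 <= G by exact: dotvv_ge0.
have D1 : 0 < D + 1 by lra.
(* The step minimizing 2 t G + t ^ 2 D, up to D + 1 > 0 in place of D. *)
have := cmin (c + (- G / (D + 1)) *: g); rewrite -subr_ge0 expand.
have -> : 2 * (- G / (D + 1)) * G + (- G / (D + 1)) ^+ 2 * D =
  - (G ^+ 2 * (D + 2) / (D + 1) ^+ 2) by field; rewrite gt_eqF.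
rewrite oppr_ge0 pmulr_lle0 ?invr_gt0 ?exprn_gt0// pmulr_lle0; last by lra.
by move=> h; apply/eqP; rewrite -sqrf_eq0 eq_le h sqr_ge0.
Qed.

Lemma eigenvalue_rayleigh m : eigenvalue A m ->
  exists2 v, 0 < dotv v v & qform v = m * dotv v v.
Proof.
move=> /eigenvalueP[v vA v0]; exists v.
  rewrite lt_neqAle dotvv_ge0 andbT eq_sym; apply: contra v0 => /eqP h.
  exact/eqP/dotvv_eq0.
rewrite /qform exchange_big /= /dotv mulr_sumr; apply: eq_bigr => j _.
have -> : \sum_i v ord0 i * v ord0 j * A i j = v ord0 j * (v *m A) ord0 j.
  by rewrite [(v *m A) ord0 j]mxE mulr_sumr; apply: eq_bigr => i _; ring.
by rewrite vA mxE; ring.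
Qed.

(** The minimal Rayleigh quotient is an eigenvalue, and no eigenvalue is
    smaller. *)
Lemma lambda_min_attained : (0 < n)%N ->
  (exists2 v, 0 < dotv v v & qform v = lambda_min A * dotv v v) /\
  (forall v, lambda_min A * dotv v v <= qform v).
Proof.
move=> n0; have [c c1 cmin] := rayleigh_min n0.
have cA := rayleigh_eigen c1 cmin.
have ec : eigenvalue A (qform c).
  apply/eigenvalueP; exists c => //; apply: contra_eq_neq c1 => ->.
  by rewrite /dotv big1 ?(eq_sym 0) ?oner_eq0// => i _; rewrite mxE mul0r.
have lb : lbound [set a | eigenvalue A a] (qform c).
  move=> m /= /eigenvalue_rayleigh[v v0 vm].
  by have := cmin v; rewrite vm ler_pM2r.
have -> : lambda_min A = qform c.
  apply/eqP; rewrite eq_le; apply/andP; split.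
    by apply: ge_inf => //; exists (qform c).
  by apply: lb_le_inf => //; exists (qform c).
by split => //; exists c; rewrite c1 ?mulr1.
Qed.

End rayleigh.

Section rayleigh_fun.
Context {R : realType} {n : nat}.
Variable A : 'M[R]_n.
Hypothesis symA : A^T = A.
Hypothesis n0 : (0 < n)%N.

Lemma lambda_min_le (a : 'I_n -> R) :
  lambda_min A * sqnorm a <= \sum_i \sum_j a i * a j * A i j.
Proof.
have [_ /(_ (\row_i a i))] := lambda_min_attained symA n0.
rewrite /dotv /qform /sqnorm; under eq_bigr => i _ do rewrite !mxE -expr2.
by under [leRHS]eq_bigr => i _ do under eq_bigr => j _ do rewrite !mxE.
Qed.

Lemma lambda_min_ge (m : R) :
  (forall a : 'I_n -> R, m * sqnorm a <= \sum_i \sum_j a i * a j * A i j) ->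
  m <= lambda_min A.
Proof.
have [[v v0 vl] _] := lambda_min_attained symA n0.
move=> /(_ (fun i => v ord0 i)); rewrite -/(qform A v) vl.
by under [sqnorm _]eq_bigr => i _ do rewrite expr2; rewrite ler_pM2r.
Qed.

End rayleigh_fun.

(** * Distance to the boundary and separation *)

Lemma fin_pos_lbound {R : realType} (I : finType) (f : I -> R) :
  (forall i, 0 < f i) -> exists2 r, 0 < r & forall i, r <= f i.
Proof.
move=> f0; exists (\big[Num.min/1]_i f i); last by move=> i; exact: bigmin_le.
by apply/bigmin_gtP; split.
Qed.

Section domain_geometry.
Context {R : realType} {d : nat}.
Variable Omega : set 'rV[R]_d.
Hypothesis oO : open Omega.
Implicit Types x y z : 'rV[R]_d.

Lemma enorm_ge0 x : 0 <= enorm x. Proof. exact: sqrtr_ge0. Qed.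

Lemma enormZ t x : enorm (t *: x) = `|t| * enorm x.
Proof.
rewrite /enorm -sqrtr_sqr -sqrtrM ?sqr_ge0//; congr Num.sqrt.
by rewrite /dotv mulr_sumr; apply: eq_bigr => i _; rewrite !mxE; ring.
Qed.

Lemma coord_le_enorm x i : `|x ord0 i| <= enorm x.
Proof.
rewrite -(sqrtr_sqr (x ord0 i)) ler_wsqrtr// /dotv (bigD1 i)//= expr2 lerDl.
by apply: sumr_ge0 => j _; rewrite -expr2 sqr_ge0.
Qed.

Lemma enorm_gt0 x : x != 0 -> 0 < enorm x.
Proof.
move=> x0; have /existsP[i xi] : [exists i, x ord0 i != 0].
  rewrite -negb_forall; apply: contra x0 => /forallP h.
  by apply/eqP/rowP => i; rewrite mxE; exact/eqP/h.
by apply: lt_le_trans (coord_le_enorm x i); rewrite normr_gt0.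
Qed.

Lemma enorm_coord_ge x (r : R) : 0 < r -> r <= enorm x ->
  exists l, r / d%:R <= `|x ord0 l|.
Proof.
move=> r0 rx; apply/existsP; rewrite -[X in is_true X]negbK negb_exists.
apply/negP => /forallP h; move: rx; apply/negP; rewrite -ltNge.
have [d0|d0] := eqVneq d 0%N.
  suff -> : enorm x = 0 by [].
  rewrite /enorm /dotv big1 ?sqrtr0// => i _; exfalso.
  by have := ltn_ord i; rewrite {2}d0.
have dd : 1 <= d%:R :> R by rewrite ler1n lt0n.
have dd0 : 0 < d%:R :> R by lra.
rewrite -(ltr_pXn2r (n := 2))// ?nnegrE ?enorm_ge0 ?(ltW r0)// enormK /dotv.
apply: (@lt_le_trans _ _ (\sum_(i < d) (r / d%:R) ^+ 2)).
  apply: ltr_sum.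
    have dp : (0 < d)%N by rewrite lt0n.
    by apply/hasP; exists (Ordinal dp) => //; exact: mem_index_enum.
  move=> i _; rewrite -expr2 -[ltLHS]real_normK ?num_real//.
  by rewrite ltr_pXn2r ?nnegrE ?divr_ge0 ?(ltW r0)//; have := h i; rewrite -ltNge.
rewrite sumr_const card_ord -(mulr_natr (_ ^+ 2)) expr_div_n -mulrA.
rewrite -[leRHS]mulr1 ler_wpM2l ?sqr_ge0// mulrC expr2 invfM mulrA mulfV ?gt_eqF// mul1r.
by rewrite invf_le1.
Qed.

Lemma segment_continuous x y : continuous (fun t : R => x + t *: (y - x)).
Proof.
by move=> t; apply: cvgD; [exact: cvg_cst|exact: cvgZr_tmp cvg_id].
Qed.

(** The boundary point is the first exit point of the segment from x to y. *)
Lemma segment_meets_boundary x y : Omega x -> ~ Omega y ->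
  exists z, boundary Omega z /\ enorm (x - z) <= enorm (x - y).
Proof.
move=> Ox nOy; pose gam (t : R) := x + t *: (y - x).
pose S := [set t : R | 0 <= t <= 1 /\ ~ Omega (gam t)].
have S1 : S 1.
  by split; rewrite ?ler01 ?lexx// /gam scale1r addrC subrK.
have lS : lbound S 0 by move=> t [/andP[]].
have hS : has_inf S by split; [exists 1|exists 0].
pose t0 := inf S.
have t0ge : 0 <= t0 by apply: lb_le_inf => //; exists 1.
have t0le : t0 <= 1 by apply: ge_inf => //; exact: hS.2.
have near_gam B : nbhs (gam t0) B ->
    exists2 e, 0 < e & forall t, `|t0 - t| < e -> B (gam t).
  move=> /(@segment_continuous x y t0) /nbhs_ballP[e /= e0 he].
  by exists e => // t; exact: he.
have nOz : ~ Omega (gam t0).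
  move=> Oz; have [e e0 he] := near_gam _ (open_nbhs_nbhs (conj oO Oz)).
  have [t tS tlt] := inf_adherent e0 hS.
  have t0t : t0 <= t by apply: ge_inf => //; exact: hS.2.
  by case: tS => _; apply; apply: he; rewrite ler0_norm; rewrite -/t0 in tlt; lra.
have t0gt : 0 < t0.
  rewrite lt_neqAle t0ge andbT; apply/eqP => t00.
  by apply: nOz; rewrite -t00 /gam scale0r addr0.
exists (gam t0); split.
  split; last by move=> /interior_subset.
  move=> B /near_gam[e e0 he].
  pose t := Num.max 0 (t0 - e / 2).
  have tlt : t < t0 by rewrite /t gt_max t0gt /=; lra.
  have tge : 0 <= t by rewrite /t le_max lexx.
  have te : t0 - e / 2 <= t by rewrite /t le_max lexx orbT.
  exists (gam t); split; last by apply: he; rewrite ger0_norm; lra.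
  apply: contrapT => nO; suff : t0 <= t by lra.
  by apply: ge_inf; [exact: hS.2|split => //; apply/andP; split; lra].
have -> : x - gam t0 = t0 *: (x - y).
  by rewrite /gam opprD addrA subrr sub0r -scalerN opprB.
by rewrite enormZ ger0_norm// ler_piMl// enorm_ge0.
Qed.

Lemma ball_in_domain (q : R) x y : Omega x ->
  (forall z, boundary Omega z -> q <= enorm (x - z)) ->
  enorm (x - y) < q -> Omega y.
Proof.
move=> Ox hq xy; apply: contrapT => nOy.
have [z [/hq zq zy]] := segment_meets_boundary Ox nOy.
by move: xy; rewrite ltNge (le_trans zq).
Qed.

Lemma boundary_away x : Omega x ->
  exists2 r, 0 < r & forall z, boundary Omega z -> r <= enorm (x - z).
Proof.
move=> Ox; have /nbhs_ballP[r /= r0 hr] := open_nbhs_nbhs (conj oO Ox).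
exists r => // z [_ nz]; rewrite leNgt; apply/negP => xz; apply: nz.
suff Oz : Omega z by exact: (open_nbhs_nbhs (conj oO Oz)).
apply: hr; split => // i j; rewrite ord1; apply: le_lt_trans xz.
by have := coord_le_enorm (x - z) j; rewrite !mxE.
Qed.

Hypothesis d0 : (0 < d)%N.
Variable M : R.
Hypothesis OM : forall v, Omega v -> forall i, `|v ord0 i| <= M.

(** A bounded set misses some point, and the segment towards it leaves Omega. *)
Lemma boundary_nonempty x : Omega x -> exists z, boundary Omega z.
Proof.
move=> Ox; have nO : ~ Omega (const_mx (M + 1)).
  move=> /OM /(_ (Ordinal d0)); rewrite mxE; have := ler_norm (M + 1); lra.
by have [z [bz _]] := segment_meets_boundary Ox nO; exists z.
Qed.

Variables (n : nat) (X : 'I_n -> 'rV[R]_d).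
Hypothesis n0 : (0 < n)%N.
Hypothesis Xinj : injective X.
Hypothesis XO : forall i, Omega (X i).

(** The two infima are positive because there are finitely many points, and the
    minimum is finite because the boundary is nonempty; hence [fine] returns it. *)
Lemma scale_spec : let q := scale Omega X in
  [/\ 0 < q,
      forall i z, boundary Omega z -> q <= enorm (X i - z) &
      forall i j, i != j -> 2 * q <= enorm (X i - X j)].
Proof.
set q := scale _ _; pose D := dist_boundary Omega X; pose S := sep_dist X.
have [z0 bz0] := boundary_nonempty (XO (Ordinal n0)).
have Dfin : (D < +oo)%E.
  apply: le_lt_trans (ltry (enorm (X (Ordinal n0) - z0))).
  by apply: ereal_inf_lbound; exists (Ordinal n0), z0.
have D0 : (0 < D)%E.
  have /choice[r hr] : forall i, exists r : R,
      0 < r /\ forall z, boundary Omega z -> r <= enorm (X i - z).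
    by move=> i; have [r r0 hr] := boundary_away (XO i); exists r.
  have [rho rho0 hrho] := fin_pos_lbound (fun i => (hr i).1).
  apply: (@lt_le_trans _ _ rho%:E); first by rewrite lte_fin.
  apply: le_ereal_inf_tmp => _ [i [z [bz ->]]]; rewrite lee_fin.
  by apply: le_trans (hrho i) _; exact: (hr i).2.
have S0 : (0 < S)%E.
  have [|rho rho0 hrho] := @fin_pos_lbound R _
    (fun p : 'I_n * 'I_n => if X p.1 == X p.2 then 1 else enorm (X p.1 - X p.2)).
    by move=> p; case: ifPn => // p12; rewrite enorm_gt0// subr_eq0.
  apply: (@lt_le_trans _ _ (2^-1 * rho)%:E); first by rewrite lte_fin mulr_gt0.
  rewrite EFinM lee_wpmul2l ?lee_fin// le_ereal_inf_tmp// => _ [i [j [ij ->]]].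
  by rewrite lee_fin; have := hrho (i, j); rewrite /= (negbTE ij).
have minE : Order.min D S = q%:E.
  rewrite /q /scale fineK// ge0_fin_numE; first by rewrite gt_min Dfin.
  by rewrite le_min !ltW.
have qD : (q%:E <= D)%E by rewrite -minE ge_min lexx.
have qS : (q%:E <= S)%E by rewrite -minE ge_min lexx orbT.
split.
- by rewrite -lte_fin -minE lt_min D0.
- move=> i z bz; rewrite -lee_fin; apply: le_trans qD _.
  by apply: ereal_inf_lbound; exists i, z.
- move=> i j ij; suff : (q%:E <= (2^-1 * enorm (X i - X j))%:E)%E by rewrite lee_fin; lra.
  apply: le_trans qS _; rewrite EFinM lee_wpmul2l ?lee_fin//.
  apply: ereal_inf_lbound; exists i, j; split => //.
  by apply: contra ij => /eqP/Xinj ->.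
Qed.

(** The point at distance q/2 from X_0 along the first axis is still in Omega. *)
Lemma scale_le : scale Omega X <= 4 * M.
Proof.
have [q0 qb _] := scale_spec; set q := scale _ _ in q0 qb *.
pose i0 := Ordinal n0; pose l0 := Ordinal d0.
pose y := X i0 + (q / 2) *: delta_mx ord0 l0.
have Oy : Omega y.
  apply: (ball_in_domain (XO i0) (qb i0)).
  rewrite /y opprD addrA subrr sub0r -scaleNr enormZ normrN.
  have -> : enorm (delta_mx ord0 l0 : 'rV[R]_d) = 1.
    rewrite /enorm /dotv (bigD1 l0)//= !mxE !eqxx mulr1 big1 ?addr0 ?sqrtr1// => l ll.
    by rewrite !mxE (negbTE ll) andbF mulr0.
  by rewrite mulr1 gtr0_norm; lra.
have := OM Oy l0; have := OM (XO i0) l0.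
rewrite /y !mxE !eqxx mulr1.
by rewrite !ler_norml => /andP[h1 h2] /andP[h3 h4]; lra.
Qed.

Lemma scale_separated : separated (2 * scale Omega X / d%:R) X.
Proof.
have [q0 _ qs] := scale_spec; move=> i j /qs h.
have [|l hl] := enorm_coord_ge _ h; first by rewrite mulr_gt0.
by exists l; move: hl; rewrite !mxE.
Qed.

End domain_geometry.

(** * The quadratic form of the convolutional kernel *)

Section convolution.
Context {R : realType} {d : nat}.
Variables (Phi Phihat : 'rV[R]_d -> R).
Hypothesis FT : fourier_transform_of Phi Phihat.
Hypothesis P0 : forall w, 0 <= Phihat w.

Let mu := lebesgue_rV d : {measure set 'rV[R]_d -> \bar R}.
Let iPhi : mu.-integrable setT (EFin \o Phihat) := FT.1.

Lemma Phi_bounded x : `|Phi x| <= @fourier_const R d * \int[mu]_w Phihat w.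
Proof.
rewrite (PhiE FT) normrM ger0_norm ?ler_pM2l ?fourier_const_gt0//; last first.
  by rewrite ltW// fourier_const_gt0.
have ic := integrable_Phihat_cos FT x.
apply: le_trans (le_normr_Rintegral measurableT ic) _.
apply: le_Rintegral => //; first exact: integrable_norm ic.
by move=> w _; rewrite normrM (ger0_norm (P0 w)) ler_piMr// cos_max.
Qed.

(** [Phi] is a partial integral of Phihat (w) (cos (w . y) + 1), shifted by a
    constant. Adding 1 to the cosine makes the integrand nonnegative, so that the
    measurability part of the Tonelli theorem applies. *)
Lemma measurable_Phi : measurable_fun setT Phi.
Proof.
pose f (p : 'rV[R]_d * 'rV[R]_d) := (Phihat p.1 * (cos (dotv p.1 p.2) + 1))%:E.
have mP : measurable_fun setT Phihat by apply/measurable_EFinP; exact: measurable_int iPhi.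
have f0 p : (0 <= f p)%E.
  by rewrite lee_fin mulr_ge0// -lerBlDr sub0r cos_geN1.
have mf : measurable_fun setT f.
  apply/measurable_EFinP; apply: measurable_funM.
    exact: (measurableT_comp mP measurable_fst).
  apply: measurable_funD => //.
  apply: (measurableT_comp (continuous_measurable_fun (@continuous_cos R))).
  apply: measurable_sum => i; apply: measurable_funM.
    exact: (measurableT_comp (measurable_coord i) measurable_fst).
  exact: (measurableT_comp (measurable_coord i) measurable_snd).
have mG := @measurable_fun_fubini_tonelli_G _ _ _ _ R (lebesgue_rV d) f mf f0.
have -> : Phi = fun y => @fourier_const R d *
    (fine (fubini_G (lebesgue_rV d) f y) - \int[mu]_w Phihat w).
  apply/funext => y; rewrite (PhiE FT); congr (_ * _).
  rewrite /fubini_G /f /= -/(Rintegral _ _ _).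
  have -> : \int[lebesgue_rV d]_w (Phihat w * (cos (dotv w y) + 1)) =
      \int[mu]_w (Phihat w * cos (dotv w y) + Phihat w).
    by apply: eq_Rintegral => w _; rewrite mulrDr mulr1.
  rewrite RintegralD//; last exact: (integrable_Phihat_cos FT).
  by rewrite addrK.
apply: measurable_funM => //; apply: measurable_funB => //.
by apply: measurableT_comp.
Qed.

Variables (k : 'rV[R]_d -> 'rV[R]_d -> R) (Omega : set 'rV[R]_d) (M : R).
Hypothesis kPhi : translational_invariant k Phi.
Hypothesis oO : open Omega.
Hypothesis OM : forall v, Omega v -> forall i, `|v ord0 i| <= M.

Let mO : measurable Omega := open_measurable_rV oO.

Lemma measurable_section x : measurable_fun setT (k x).
Proof.
have -> : k x = fun y => Phi (y + - x).
  by apply/funext => y; rewrite kPhi.1 kPhi.2.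
exact: (measurableT_comp measurable_Phi (@measurable_addv R d (- x))).
Qed.

Lemma Omega_lty : (mu Omega < +oo)%E.
Proof.
have OB : Omega `<=` box `|M|.
  by move=> v /OM h i; exact: le_trans (h i) (ler_norm _).
apply: (@le_lt_trans _ _ (mu (box `|M|))); last exact: lebesgue_box_lty.
apply: le_measure => //; rewrite inE//; exact: measurable_box.
Qed.

Lemma integrable_sections x z : mu.-integrable Omega (EFin \o (fun y => k x y * k y z)).
Proof.
apply: measurable_bounded_integrable => //; first exact: Omega_lty.
  apply: measurable_funTS; apply: measurable_funM; first exact: measurable_section.
  rewrite (_ : k^~ z = k z); first exact: measurable_section.
  by apply/funext => y; rewrite kPhi.1.
pose C := @fourier_const R d * \int[mu]_w Phihat w.
exists (C * C); split; first exact: num_real.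
move=> B CB y _ /=; apply: le_trans (ltW CB).
by rewrite normrM ler_pM// !kPhi.2 Phi_bounded.
Qed.

Variables (n : nat) (a : 'I_n -> R) (X : 'I_n -> 'rV[R]_d).

Let f y := \sum_i a i * k (X i) y.

Let f2E y : f y ^+ 2 =
  \sum_(p : 'I_n * 'I_n) (a p.1 * a p.2) * (k (X p.1) y * k y (X p.2)).
Proof.
rewrite -(pair_bigA _ (fun i j => a i * a j * (k (X i) y * k y (X j)))) /=.
rewrite expr2 /f mulr_suml; apply: eq_bigr => i _.
rewrite mulr_sumr; apply: eq_bigr => j _.
by rewrite (kPhi.1 y); ring.
Qed.

Let integrable_f2_term (p : 'I_n * 'I_n) : mu.-integrable Omega
  (EFin \o (fun y => (a p.1 * a p.2) * (k (X p.1) y * k y (X p.2)))).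
Proof.
have := integrableZl mO (a p.1 * a p.2) (integrable_sections (X p.1) (X p.2)).
by apply: eq_integrable => // x _ /=; rewrite EFinM.
Qed.

Lemma conv_formE :
  \sum_i \sum_j a i * a j * conv_kernel Omega k (X i) (X j) =
  \int[mu]_(y in Omega) (f y ^+ 2).
Proof.
under [RHS]eq_Rintegral => y _ do rewrite f2E.
rewrite Rintegral_sum// pair_bigA; apply: eq_bigr => -[i j] _ /=.
by rewrite RintegralZl//; exact: integrable_sections.
Qed.

Variables (rho L : R).
Hypothesis rho0 : 0 <= rho.
Hypothesis L0 : 0 <= L.
Hypothesis form_lower : forall u, box rho u ->
  L * sqnorm a <= \sum_i \sum_j a i * a j * Phi (X i - X j + u).
Hypothesis cubes_in : forall j u, box rho u -> Omega (u + X j).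
Hypothesis cubes_disjoint : forall i j u v, box rho u -> box rho v ->
  u + X i = v + X j -> i = j.

(** With t = L a_j in f^2 >= 2 t f - t^2, summed over j; the sum of the
    a_j f(u + x_j) is the quadratic form shifted by -u. *)
Lemma sum_sq_lower u : box rho u -> L ^+ 2 * sqnorm a <= \sum_j f (u + X j) ^+ 2.
Proof.
move=> bu; have bNu : box rho (- u) by move=> l; rewrite mxE normrN; exact: bu.
have cross : \sum_j a j * f (u + X j) = \sum_i \sum_j a i * a j * Phi (X i - X j + (- u)).
  rewrite exchange_big /=; apply: eq_bigr => j _; rewrite mulr_sumr.
  by apply: eq_bigr => i _; rewrite kPhi.2 opprD [- u + _]addrC addrA; ring.
apply: (@le_trans _ _ (2 * L * (\sum_j a j * f (u + X j)) - L ^+ 2 * sqnorm a)).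
  by have := ler_wpM2l L0 (form_lower bNu); rewrite -cross expr2; lra.
rewrite /sqnorm !mulr_sumr -sumrB; apply: ler_sum => j _.
by have := sqr_ge0 (f (u + X j) - L * a j); rewrite !expr2; lra.
Qed.

(** Restrict the integral of f^2 to the disjoint cubes around the points,
    translate all of them to the origin and apply [sum_sq_lower] under the integral. *)
Lemma conv_form_lower :
  L ^+ 2 * (2 * rho) ^+ d * sqnorm a <=
    \sum_i \sum_j a i * a j * conv_kernel Omega k (X i) (X j).
Proof.
rewrite conv_formE.
have mF : measurable_fun setT (fun y => (f y ^+ 2)%:E).
  apply/measurable_EFinP; apply: measurable_funX; apply: measurable_sum => i.
  by apply: measurable_funM => //; exact: measurable_section.
have F0 y : (0 <= (f y ^+ 2)%:E)%E by rewrite lee_fin sqr_ge0.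
have iF : mu.-integrable Omega (fun y => (f y ^+ 2)%:E).
  have := integrable_sum mO (index_enum ('I_n * 'I_n)%type)
    (fun p (_ : xpredT p) => integrable_f2_term p).
  by apply: eq_integrable => // y _; rewrite sumEFin f2E.
rewrite -lee_fin /Rintegral fineK; last exact: integrable_fin_num.
pose B j := (fun y => y - X j) @^-1` (@box R d rho).
have mB j : measurable (B j).
  by rewrite -[B j]setTI; apply: measurable_addv => //; exact: measurable_box.
have tB : trivIset [set` index_enum 'I_n] B.
  move=> i j _ _ [y [/= yi yj]]; apply: (cubes_disjoint yi yj).
  by rewrite !subrK.
have BO : \big[setU/set0]_(j <- index_enum 'I_n) B j `<=` Omega.
  rewrite -bigcup_seq => y [j _ yj].
  by rewrite -(subrK (X j) y); exact: cubes_in.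
apply: (@le_trans _ _
    (\int[mu]_(y in \big[setU/set0]_(j <- index_enum 'I_n) B j) (f y ^+ 2)%:E)%E);
  last first.
  apply: ge0_subset_integral => //; first exact: bigsetU_measurable.
  exact: measurable_funS mF.
rewrite ge0_integral_bigsetU//; last 2 first.
- exact: index_enum_uniq.
- exact: measurable_funS mF.
have shift j : (\int[mu]_(y in B j) (f y ^+ 2)%:E =
    \int[mu]_(u in box rho) (f (u + X j) ^+ 2)%:E)%E.
  rewrite integral_mkcond [RHS]integral_mkcond.
  rewrite -(lebesgue_rV_shift (X j) (F := (fun y => (f y ^+ 2)%:E) \_ (B j))).
  - apply: eq_integral => u _; rewrite /patch; congr (if _ then _ else _).
    by rewrite /B; apply/idP/idP; rewrite !inE /= addrK.
  - by apply/(measurable_restrictT _ (mB j)); exact: measurable_funS mF.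
  - by move=> v; exact: erestrict_ge0.
have mFs j : measurable_fun (box rho) (fun u => (f (u + X j) ^+ 2)%:E).
  apply: measurable_funTS.
  exact: (measurableT_comp mF (@measurable_addv R d (X j))).
have mb := @measurable_box R d rho.
under eq_bigr => j _ do rewrite shift.
rewrite -ge0_integral_sum//.
apply: (@le_trans _ _ (\int[mu]_(u in box rho) (L ^+ 2 * sqnorm a)%:E)%E).
  have volE : mu (box rho) = ((2 * rho) ^+ d)%:E by exact: lebesgue_box.
  rewrite integral_cst// volE -EFinM lee_fin le_eqVlt.
  by apply/orP; left; apply/eqP; ring.
apply: ge0_le_integral => //.
- by move=> u _; rewrite lee_fin mulr_ge0 ?sqr_ge0 ?sqnorm_ge0.
- by apply: emeasurable_sum => j.
by move=> u bu; rewrite sumEFin lee_fin sum_sq_lower.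
Qed.

End convolution.

(** * Constants and conclusion *)

Section constants.
Context {R : realType} {d : nat}.
Variables (Phi Phihat : 'rV[R]_d -> R) (tau cPhi CPhi : R).
Hypothesis dpos : (0 < d)%N.
Hypothesis FT : fourier_transform_of Phi Phihat.
Hypothesis c0 : 0 < cPhi.
Hypothesis C0 : 0 < CPhi.
Hypothesis tau0 : d%:R / 2 < tau.
Hypothesis Phi_bnd : forall w, cPhi * (1 + enorm w ^+ 2) `^ (- tau) <= Phihat w /\
             Phihat w <= CPhi * (1 + enorm w ^+ 2) `^ (- tau).

Let iPhi : (lebesgue_rV d).-integrable setT (EFin \o Phihat) := FT.1.
(* The large sieve applies as soon as s * delta >= K. *)
Let K : R := 6 ^+ d.+1.
Let e : R := 2 * tau - d%:R.

Let dR : 0 < d%:R :> R. Proof. by rewrite ltr0n. Qed.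
Let K6 : 6 <= K.
Proof. by rewrite /K exprS ler_peMr// exprn_ege1//; lra. Qed.
Let K12 : 12 * 6 ^+ d <= K ^+ 2.
Proof.
have h : 1 <= 6 ^+ d :> R by rewrite exprn_ege1//; lra.
by rewrite /K [6 ^+ d.+1]exprS expr2; move: (6 ^+ d : R) h => y y1; nra.
Qed.
Let e0 : 0 < e. Proof. by have := tau0; rewrite /e; lra. Qed.

(** [Q] is an upper bound on the scale q. It is used to absorb the 1 in
    1 + d s^2 for s of order 1/q. *)
Definition low_const (Q : R) : R :=
  cPhi * (Q ^+ 2 + d%:R * (K * d%:R / 2) ^+ 2) `^ (- tau) *
  (1 / 2 * (2 / 3 * (K * d%:R)) ^+ d).

Lemma low_const_gt0 (Q : R) : 0 < low_const Q.
Proof.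
have h : 0 < d%:R * (K * d%:R / 2) ^+ 2.
  by rewrite mulr_gt0// exprn_gt0// !mulr_gt0//; have := K6; lra.
rewrite /low_const !mulr_gt0// ?exprn_gt0 ?powR_gt0// ?ltr_wpDl ?sqr_ge0//.
by rewrite !mulr_gt0//; have := K6; lra.
Qed.

(** [energy_low] for s = K d / (2 q), a width to which the large sieve applies
    because the points have separation delta = 2 q / d and s * delta = K. *)
Lemma energy_low_scaled (Q q : R) n (a : 'I_n -> R) (X : 'I_n -> 'rV[R]_d) :
  0 < q -> q <= Q -> separated (2 * q / d%:R) X ->
  low_const Q * q `^ e * sqnorm a <= energy Phihat a X.
Proof.
move=> q0 qQ sep.
have [s sE] : exists s, s = K * d%:R / (2 * q) by exists (K * d%:R / (2 * q)).
have K0 : 0 < K by have := K6; lra.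
have s0 : 0 < s by rewrite sE divr_gt0 ?mulr_gt0.
have dl0 : 0 < 2 * q / d%:R by rewrite divr_gt0 ?mulr_gt0.
have sd : s * (2 * q / d%:R) = K by rewrite sE; field; rewrite !gt_eqF.
have := energy_low iPhi c0 tau0 Phi_bnd a dl0 sep s0.
rewrite sd => /(_ K12); apply: le_trans.
rewrite [1 / 2 * (_ * sqnorm a)]mulrA [leRHS]mulrA ler_wpM2r ?sqnorm_ge0//.
pose B : R := Q ^+ 2 + d%:R * (K * d%:R / 2) ^+ 2.
have B0 : 0 < B.
  rewrite ltr_wpDl ?sqr_ge0// mulr_gt0// exprn_gt0// divr_gt0// mulr_gt0//.
have hs : 1 + d%:R * s ^+ 2 <= B / q ^+ 2.
  rewrite ler_pdivlMr ?exprn_gt0// /B mulrDl mul1r lerD//.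
    by rewrite lerXn2r ?nnegrE ?(ltW q0)// (le_trans (ltW q0)).
  by rewrite le_eqVlt sE; apply/orP; left; apply/eqP; field; rewrite gt_eqF.
have s1 : 0 < 1 + d%:R * s ^+ 2 by rewrite ltr_pwDl// mulr_ge0 ?sqr_ge0// ltW.
have hp : B `^ (- tau) * q `^ (2 * tau) <= (1 + d%:R * s ^+ 2) `^ (- tau).
  apply: le_trans (powR_negS tau0 s1 hs).
  rewrite powRM ?invr_ge0 ?sqr_ge0 ?(ltW B0)// le_eqVlt; apply/orP; left; apply/eqP.
  congr (_ * _); rewrite -powR_invn ?(ltW q0)// -powRrM; congr (_ `^ _); ring.
have qe : q `^ e = q `^ (2 * tau) * q ^- d.
  by rewrite /e powRD ?(gt_eqF q0) ?implybT// powR_invn// ltW.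
have qd : (4 / 3 * s) ^+ d = (2 / 3 * (K * d%:R)) ^+ d * q ^- d.
  by rewrite -exprVn -exprMn; congr (_ ^+ d); rewrite sE; field; rewrite gt_eqF.
rewrite qd qe /low_const -/B.
have P0 : 0 <= cPhi * (1 / 2 * (2 / 3 * (K * d%:R)) ^+ d * q ^- d).
  by rewrite !mulr_ge0 ?invr_ge0 ?exprn_ge0 ?mulr_ge0
    ?(ltW c0) ?(ltW K0) ?(ltW dR) ?(ltW q0).
have H := ler_wpM2l P0 hp.
rewrite [leLHS](_ : _ = cPhi * (1 / 2 * (2 / 3 * (K * d%:R)) ^+ d / q ^+ d) *
  (B `^ (- tau) * q `^ (2 * tau))); last by ring.
apply: le_trans H _; rewrite le_eqVlt; apply/orP; left; apply/eqP; ring.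
Qed.

(** [energy_high] for s = Lambda / q: the same power of q as in
    [energy_low_scaled], with a factor that is small for large Lambda. *)
Lemma energy_high_scaled (Lam q : R) n (a : 'I_n -> R) (X : 'I_n -> 'rV[R]_d) :
  0 < q -> K * d%:R <= Lam -> separated (2 * q / d%:R) X ->
  \int[lebesgue_rV d]_(w in ~` box (Lam / q)) (Phihat w * expsum2 a X w) <=
    high_const (d := d) CPhi / (1 - 2 `^ (d%:R - 2 * tau)) * Lam `^ (- e) * q `^ e * sqnorm a.
Proof.
move=> q0 KL sep; have K0 : 0 < K by have := K6; lra.
have L0 : 0 < Lam by apply: lt_le_trans KL; rewrite mulr_gt0.
have s0 : 0 < Lam / q by rewrite divr_gt0.
have dl0 : 0 < 2 * q / d%:R by rewrite divr_gt0 ?mulr_gt0.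
have h : 12 * 6 ^+ d <= (Lam / q * (2 * q / d%:R)) ^+ 2.
  apply: le_trans K12 _.
  rewrite lerXn2r ?nnegrE ?mulr_ge0 ?invr_ge0 ?(ltW K0) ?(ltW L0) ?(ltW q0)//.
  have -> : Lam / q * (2 * q / d%:R) = 2 * Lam / d%:R by field; rewrite !gt_eqF.
  by rewrite ler_pdivlMr//; have := L0; lra.
have := energy_high iPhi c0 C0 tau0 Phi_bnd a dl0 sep s0 h.
move/le_trans; apply; rewrite le_eqVlt; apply/orP; left; apply/eqP.
have -> : (Lam / q) `^ (d%:R - 2 * tau) = Lam `^ (- e) * q `^ e.
  rewrite powRM ?invr_ge0 ?(ltW L0) ?(ltW q0)// /e opprB; congr (_ * _).
  by rewrite -powR_inv1 ?(ltW q0)// -powRrM; congr (_ `^ _); ring.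
by ring.
Qed.

Lemma cutoff_exists (Q : R) : exists2 Lam, K * d%:R <= Lam &
  high_const (d := d) CPhi / (1 - 2 `^ (d%:R - 2 * tau)) * Lam `^ (- e) <= low_const Q / 6.
Proof.
set C := high_const _ / _; have C1 : 0 < C.
  rewrite divr_gt0 ?subr_gt0 ?dyadic_exp_lt1// /high_const.
  by rewrite !mulr_gt0// ?exprn_gt0//.
have c1 := low_const_gt0 Q; have K0 : 0 < K by have := K6; lra.
pose r := 6 * C / low_const Q; have r0 : 0 < r by rewrite divr_gt0// mulr_gt0.
(* The second entry makes Lam ^ e at least 6 C / low_const Q. *)
pose Lam := Num.max (K * d%:R) (r `^ e^-1).
have L0 : 0 < Lam by rewrite lt_max mulr_gt0.
exists Lam; first by rewrite le_max lexx.
have rL : r <= Lam `^ e.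
  have -> : r = (r `^ e^-1) `^ e.
    by rewrite -powRrM mulVf ?gt_eqF// powRr1// ltW.
  apply: ge0_ler_powR; rewrite ?(ltW e0) ?nnegrE ?powR_ge0 ?(ltW L0)//.
  by rewrite le_max lexx orbT.
rewrite powRN ler_pdivrMr ?powR_gt0//.
apply: (@le_trans _ _ (low_const Q / 6 * r)); last by rewrite ler_wpM2l// divr_ge0// ltW.
rewrite le_eqVlt; apply/orP; left; apply/eqP; rewrite /r; field.
by rewrite gt_eqF.
Qed.

End constants.

Theorem corollary5 (R : realType) (d : nat) (Omega : set 'rV[R]_d)
    (k : 'rV[R]_d -> 'rV[R]_d -> R) (Phi Phihat : 'rV[R]_d -> R)
    (tau cPhi CPhi : R) :
  (0 < d)%N ->
  is_domain Omega -> bounded_set Omega ->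
  translational_invariant k Phi ->
  fourier_transform_of Phi Phihat ->
  d%:R / 2 < tau -> 0 < cPhi -> 0 < CPhi ->
  (forall w, cPhi * (1 + enorm w ^+ 2) `^ (- tau) <= Phihat w /\
             Phihat w <= CPhi * (1 + enorm w ^+ 2) `^ (- tau)) ->
  exists c c' : R, [/\ 0 < c, 0 < c' &
    forall (n : nat) (X : 'I_n -> 'rV[R]_d),
      (0 < n)%N -> injective X -> (forall i, Omega (X i)) ->
      let q := scale Omega X in
      [/\ 0 < q,
          lambda_min (kernel_matrix (conv_kernel Omega k) X) >=
            c * q ^+ d * lambda_min (kernel_matrix k X) ^+ 2 &
          c * q ^+ d * lambda_min (kernel_matrix k X) ^+ 2 >=
            c' * q `^ (4 * tau - d%:R)]].
Proof.
move=> d0 [_ oO _] bO kPhi FT tau0 c0 C0 Phi_bnd.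
have [M M0 OM] : exists2 M : R, 0 < M & forall v, Omega v -> forall i, `|v ord0 i| <= M.
  have [N [_ hN]] := bO; exists (`|N| + 1); first by rewrite ltr_wpDl.
  move=> v Ov i; have := hN (`|N| + 1); rewrite (le_lt_trans (ler_norm N)) ?ltrDl//.
  move=> /(_ isT v Ov) /=; apply: le_trans.
  rewrite [leRHS]/Num.norm /= mx_normrE.
  exact: (le_bigmax _ (fun p : 'I_1 * 'I_d => `|v p.1 p.2|) (ord0, i)).
pose e : R := 2 * tau - d%:R; pose c1 := @low_const R d tau cPhi (4 * M).
have [Lam KL hLam] := cutoff_exists d0 c0 C0 tau0 (4 * M).
have dR : 1 <= d%:R :> R by rewrite ler1n.
have Lam1 : 1 < Lam.
  apply: lt_le_trans KL; apply: lt_le_trans (_ : 6 ^+ d.+1 <= _); last first.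
    by rewrite ler_peMr// exprn_ge0.
  by rewrite exprn_egt1//; lra.
have L0 : 0 < Lam by lra.
pose eps := (d%:R * Lam)^-1; have eps0 : 0 < eps by rewrite invr_gt0 mulr_gt0//; lra.
pose kap := @fourier_const R d; have kap0 : 0 < kap by exact: fourier_const_gt0.
have c10 : 0 < c1 by exact: low_const_gt0.
pose c := (2 * eps) ^+ d / 16; have cpos : 0 < c by rewrite divr_gt0// exprn_gt0// mulr_gt0.
(* Cubes of half-side eps * q satisfy |u_l| d (Lambda / q) <= 1, the condition
   of [shifted_energy]; their volume is (2 eps q) ^ d, and 16 = 4 ^ 2 comes from
   the quarter of the unshifted form that survives. *)
exists c, (c * (kap * c1) ^+ 2); split => //; first by rewrite mulr_gt0// exprn_gt0// mulr_gt0.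
move=> n X n0 Xinj XO q.
have [q0 qb qs] := scale_spec oO d0 OM n0 Xinj XO; rewrite -/q in q0 qb qs.
have qM : q <= 4 * M := scale_le oO d0 OM n0 Xinj XO.
have sep : separated (2 * q / d%:R) X := scale_separated oO d0 OM n0 Xinj XO.
set lamk := lambda_min (kernel_matrix k X).
have symk : (kernel_matrix k X)^T = kernel_matrix k X.
  by apply/matrixP => i j; rewrite !mxE kPhi.1.
have symc : (kernel_matrix (conv_kernel Omega k) X)^T = kernel_matrix (conv_kernel Omega k) X.
  apply/matrixP => i j; rewrite !mxE; apply: eq_Rintegral => y _.
  by rewrite mulrC kPhi.1 [k y _]kPhi.1.
have formk a : \sum_i \sum_j a i * a j * kernel_matrix k X i j = kap * energy Phihat a X.
  rewrite -(quadratic_form0 FT); apply: eq_bigr => i _; apply: eq_bigr => j _.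
  by rewrite mxE kPhi.2.
have lamk_lower : kap * c1 * q `^ e <= lamk.
  apply: lambda_min_ge => // a; rewrite formk -(mulrA kap) -(mulrA kap) ler_pM2l//.
  exact: (energy_low_scaled d0 FT c0 tau0 Phi_bnd a q0 qM sep).
have qe0 : 0 < q `^ e by rewrite powR_gt0.
have lower0 : 0 <= kap * c1 * q `^ e.
  by apply: mulr_ge0; [apply: mulr_ge0|]; exact: ltW.
have lamk0 : 0 <= lamk by exact: le_trans lamk_lower.
have s0 : 0 < Lam / q by rewrite divr_gt0.
have rho_l (u : 'rV[R]_d) : box (eps * q) u -> forall l, `|u ord0 l| * (d%:R * (Lam / q)) <= 1.
  move=> bu l; apply: le_trans (_ : eps * q * (d%:R * (Lam / q)) <= _).
    by rewrite ler_wpM2r ?bu// mulr_ge0// ltW.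
  rewrite le_eqVlt /eps; apply/orP; left; apply/eqP; field.
  by rewrite !gt_eqF//; lra.
have form_lower a u : box (eps * q) u ->
    lamk / 4 * sqnorm a <= \sum_i \sum_j a i * a j * Phi (X i - X j + u).
  move=> /rho_l bu; rewrite (quadratic_formE FT).
  apply: (@le_trans _ _ (kap * (energy Phihat a X / 4))).
    by have := lambda_min_le symk n0 a; rewrite formk -/lamk; lra.
  rewrite ler_pM2l//; apply: (shifted_energy FT c0 Phi_bnd s0 bu).
  apply: le_trans (energy_high_scaled d0 FT c0 C0 tau0 Phi_bnd a q0 KL sep) _.
  have lo := energy_low_scaled d0 FT c0 tau0 Phi_bnd a q0 qM sep.
  apply: (@le_trans _ _ (c1 / 6 * q `^ e * sqnorm a)); last by rewrite -/c1 -/e in lo; lra.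
  by rewrite ler_wpM2r ?sqnorm_ge0// ler_wpM2r// ltW.
have epsd : eps * q < q / d%:R.
  by rewrite mulrC ltr_pM2l// /eps ltf_pV2 ?posrE ?mulr_gt0//; first nra; lra.
split => //; last first.
  have -> : c * (kap * c1) ^+ 2 * q `^ (4 * tau - d%:R) =
      c * q ^+ d * (kap * c1 * q `^ e) ^+ 2.
    have -> : 4 * tau - d%:R = d%:R + e * 2%:R by rewrite /e; ring.
    rewrite powRD ?(gt_eqF q0) ?implybT// powRrM !powR_mulrn ?powR_ge0 ?(ltW q0)//.
    by ring.
  apply: ler_wpM2l; first by apply: mulr_ge0; [|apply: exprn_ge0]; exact: ltW.
  by rewrite lerXn2r ?nnegrE.
apply: lambda_min_ge => // a.
under [leRHS]eq_bigr => i _ do under eq_bigr => j _ do rewrite mxE.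
have -> : c * q ^+ d * lamk ^+ 2 = (lamk / 4) ^+ 2 * (2 * (eps * q)) ^+ d.
  by rewrite mulrA [(2 * eps * q) ^+ d]exprMn /c; field.
apply: (conv_form_lower FT (Phihat_ge0 c0 Phi_bnd) kPhi oO OM) => //.
- by rewrite mulr_ge0// ltW.
- by rewrite divr_ge0.
- by move=> u; exact: form_lower.
- move=> j u bu; apply: (ball_in_domain oO (XO j) (qb j)).
  rewrite opprD addrCA subrr addr0 ltNge; apply/negP => hq.
  have [l] := enorm_coord_ge q0 hq; rewrite mxE normrN leNgt => /negP; apply.
  exact: le_lt_trans (bu l) epsd.
- move=> i j u v bu bv uv; apply/eqP; apply: contraT => /sep[l].
  rewrite leNgt => /negP; case.
  have -> : X i ord0 l - X j ord0 l = v ord0 l - u ord0 l.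
    by move/rowP/(_ l): uv; rewrite !mxE; lra.
  apply: le_lt_trans (ler_normB _ _) _; apply: (@le_lt_trans _ _ (eps * q + eps * q)).
    by rewrite lerD ?bu ?bv.
  by rewrite -mulrA; lra.
Qed.
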